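(* Let $P\subset\mathbb{R}^d$ be a $d$-dimensional integral generic orthotope and let $k\in\{0,1,2,\dots,d\}$. Then, in the algebra $\mathcal{F}$, $$\sum_{\alpha}L_{\alpha,k}(P)\,e_\alpha=2^{k-d}\sum_{\deg\alpha=k}C_{\alpha,\deg\alpha}(P)\,D(h^{-1}(e_\alpha)),$$ where the left sum is over all congruence classes $\alpha$ of floral arrangements in $\mathbb{R}^d$ and the right sum is over those congruence classes with $\deg\alpha=k$.
   Context: Floral arrangements. For $i\in[d]=\{1,\dots,d\}$ the coordinate half-spaces are $\{x\in\mathbb{R}^d:x_i\ge 0\}$ and $\{x\in\mathbb{R}^d:x_i\le 0\}$. A floral arrangement in $\mathbb{R}^d$ is a subset $\alpha\subset\mathbb{R}^d$ that is either $\mathbb{R}^d$ itself or is given, for some nonempty $I\subset[d]$ and a choice of one coordinate half-space $H_i$ for each $i\in I$, by an expression built from the $H_i$ using binary $\cap$ and $\cup$ in which each $H_i$ ($i\in I$) appears exactly once (a read-once expression). The set $I$ is determined by $\alpha$; $\dim\alpha:=|I|$ and $\deg\alpha:=d-|I|$ (with $I=\emptyset$ for $\alpha=\mathbb{R}^d$). A floral vertex of dimension $k$ is a floral arrangement $\beta\subset\mathbb{R}^k$ with $\dim\beta=k$; the trivial one, of dimension $0$ (namely $\mathbb{R}^0$), is denoted $\mathsf{o}$. Two floral arrangements in $\mathbb{R}^d$ are congruent if one is the image of the other under a signed permutation matrix (element of the Coxeter group $BC_d$). Every floral arrangement in $\mathbb{R}^d$ of dimension $k$ is congruent to $\beta\times\mathbb{R}^{d-k}$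 for a floral vertex $\beta$ of dimension $k$, unique up to congruence; thus congruence classes of floral arrangements in $\mathbb{R}^d$ are identified with congruence classes of floral vertices of dimension at most $d$ ($\mathbb{R}^d$ corresponds to $\mathsf{o}$). Generic orthotopes. The tangent cone of a set $Q\subset\mathbb{R}^d$ at $x\in Q$ is $\{v\in\mathbb{R}^d: x+\varepsilon v\in Q\text{ for all sufficiently small }\varepsilon>0\}$. A $d$-dimensional integral generic orthotope is a bounded set $P\subset\mathbb{R}^d$ that is a finite union of integral unit cubes $v+[0,1]^d$, $v\in\mathbb{Z}^d$, such that the tangent cone of $P$ at every point of $P$ is a floral arrangement in $\mathbb{R}^d$. A $k$-dimensional relatively open integral unit cube is a product $\prod_{i=1}^d J_i$ where each $J_i$ is $\{n_i\}$ or the open interval $(n_i,n_i+1)$ with $n_i\in\mathbb{Z}$, exactly $k$ of them being intervals. For such a cube contained in $P$, the tangent cones of $P$ at all its points lie in one congruence class, called its floral type. $C_{\alpha,k}(P)$ is the number of relatively open $k$-dimensional integral unit cubes $C\subset P$ of floral type $\alpha$. Lattice point counts. $L_\alpha(P)$ is the number of $x\in P\cap\mathbb{Z}^d$ at which the tangent cone of $P$ lies in the class $\alpha$. For positive integers $t$, $L_\alpha(tP)$ is a polynomial function of $t$, and $L_{\alpha,k}(P)$ denotes its coefficients: $L_\alpha(tP)=\sum_k L_{\alpha,k}(P)t^k$. The algebra $\mathcal{F}$. $\mathcal{F}$ is the $\mathbb{Q}$-vector space with basis $\{e_\alpha\}$, $\alpha$ ranging over all congruence classes of floral vertices of all dimensions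 (including $\mathsf{o}$), with commutative product $e_\alpha\cdot e_\beta=e_{\alpha\wedge\beta}$, where $\alpha\wedge\beta$ is the class of the product floral vertex $\alpha\times\beta$; the unit is $e_{\mathsf{o}}$. For a floral vertex $\alpha$, a point $x\in\alpha\subset\mathbb{R}^{\dim\alpha}$ has floral type $\beta$ if the tangent cone of $\alpha$ at $x$ is congruent to $\beta\times\mathbb{R}^{\dim\alpha-\dim\beta}$. A generalized orthant of $\mathbb{R}^n$ is a set $\Omega_s=\{x\in\mathbb{R}^n:\mathrm{sign}(x_i)=s_i\ \forall i\}$ with $s\in\{-1,0,1\}^n$; its dimension is $\#\{i:s_i\ne0\}$. The integer $m_{\alpha,\beta}$ is the number of $(\dim\alpha-\dim\beta)$-dimensional generalized orthants $\Omega\subset\alpha$ all of whose points have floral type $\beta$ ($m_{\alpha,\beta}=0$ if $\dim\beta>\dim\alpha$). The linear map $h:\mathcal{F}\to\mathcal{F}$ is $h(e_\alpha)=\sum_\beta m_{\alpha,\beta}e_\beta$; it is bijective, with inverse $h^{-1}$. The linear map $D:\mathcal{F}\to\mathcal{F}$ is $D(e_\alpha)=2^{\dim\alpha}e_\alpha$. *)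

(* Defs.v *)
From HB Require Import structures.
From mathcomp Require Import all_boot all_order all_algebra finmap generic_quotient.
From mathcomp Require Import boolp classical_sets functions cardinality fsbigop.
From mathcomp Require Import reals.
From mathcomp.multinomials Require Import monalg.

Set Implicit Arguments.
Unset Strict Implicit.
Unset Printing Implicit Defensive.

Import Order.TTheory GRing.Theory Num.Theory.

Local Open Scope quotient_scope.
Local Open Scope classical_set_scope.
Local Open Scope ring_scope.

Section FloralArrangements.
Variable R : realType.

(** [Half i b] is the half-space [x_i >= 0] if [b], and [x_i <= 0] otherwise. *)
Inductive floral_expr (d : nat) : Type :=
| Half of 'I_d & bool
| Cap of floral_expr d & floral_expr d
| Cup of floral_expr d & floral_expr d.

Fixpoint expr_vars d (e : floral_expr d) : seq 'I_d :=
  match e with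
  | Half i _ => [:: i]
  | Cap e1 e2 | Cup e1 e2 => expr_vars e1 ++ expr_vars e2
  end.

Fixpoint expr_set d (e : floral_expr d) : set 'rV[R]_d :=
  match e with
  | Half i b => [set x | if b then 0 <= x 0 i else x 0 i <= 0]
  | Cap e1 e2 => expr_set e1 `&` expr_set e2
  | Cup e1 e2 => expr_set e1 `|` expr_set e2
  end.

(** [I] is the set of coordinates occurring in the arrangement [A], so that
    [#|I|] is the dimension of [A]. *)
Definition floral_on d (I : {set 'I_d}) (A : set 'rV[R]_d) : Prop :=
  (#|I| = 0%N /\ A = [set: 'rV[R]_d]) \/
  exists e : floral_expr d,
    [/\ uniq (expr_vars e), I =i expr_vars e & A = expr_set e].

Definition floral_arrangement d (A : set 'rV[R]_d) : Prop :=
  exists I : {set 'I_d}, floral_on I A.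

Record floral_vertex : Type := FloralVertex {
  fv_dim : nat;
  fv_set : set 'rV[R]_fv_dim;
  fv_floral : floral_on [set: 'I_fv_dim]%SET fv_set
}.

Arguments fv_set : clear implicits.
Arguments fv_floral : clear implicits.

HB.instance Definition _ := gen_eqMixin floral_vertex.
HB.instance Definition _ := gen_choiceMixin floral_vertex.

(** For a bijection [s] (which forces [m = n]) this is multiplication by a
    signed permutation matrix.  Keeping [m] and [n] distinct avoids casts. *)
Definition signed_perm m n (s : 'I_n -> 'I_m) (e : 'I_n -> bool)
    (x : 'rV[R]_m) : 'rV[R]_n :=
  \row_j ((-1) ^+ e j * x 0 (s j)).

Definition congruent m n (A : set 'rV[R]_m) (B : set 'rV[R]_n) : Prop :=
  exists (s : 'I_n -> 'I_m) (e : 'I_n -> bool),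
    bijective s /\ B = signed_perm s e @` A.

Definition row_prod m n (A : set 'rV[R]_m) (B : set 'rV[R]_n) :
    set 'rV[R]_(m + n) :=
  [set x | A (lsubmx x) /\ B (rsubmx x)].

Lemma congruentP m n (A : set 'rV[R]_m) (B : set 'rV[R]_n) :
  congruent A B <->
  exists (s : 'I_n -> 'I_m) (e : 'I_n -> bool),
    bijective s /\ forall x, A x <-> B (signed_perm s e x).
Proof.
split=> -[s [e [bs H]]]; exists s, e; split=> //.
  case: bs => t sK tK x; rewrite H; split=> [Ax|[y Ay /rowP yx]].
    by exists x.
  suff -> : x = y by [].
  apply/rowP => i; have := yx (t i); rewrite !mxE tK.
  move=> /(congr1 ( *%R ((-1) ^+ e (t i)))).
  by rewrite !mulrA -expr2 sqrr_sign !mul1r.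
case: bs => t sK tK; apply/seteqP; split=> [y By|_ [x Ax <-]]; last exact/H.
have E : signed_perm s e (\row_i ((-1) ^+ e (t i) * y 0 (t i))) = y.
  by apply/rowP => j; rewrite !mxE sK mulrA -expr2 sqrr_sign mul1r.
by exists (\row_i ((-1) ^+ e (t i) * y 0 (t i))) => //; apply/H; rewrite E.
Qed.

Lemma congruent_refl n (A : set 'rV[R]_n) : congruent A A.
Proof.
apply/congruentP; exists id, (fun=> false); split; first by exists id.
move=> x; suff -> : signed_perm id (fun=> false) x = x by [].
by apply/rowP => j; rewrite mxE mul1r.
Qed.

Lemma congruent_sym m n (A : set 'rV[R]_m) (B : set 'rV[R]_n) :
  congruent A B -> congruent B A.
Proof.
move=> /congruentP[s [e [[t sK tK] H]]]; apply/congruentP.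
exists t, (e \o t); split; first by exists s.
move=> y; rewrite H; set z := signed_perm _ _ _.
suff -> : z = y by [].
by apply/rowP => j; rewrite !mxE /= sK mulrA -expr2 sqrr_sign mul1r.
Qed.

Lemma congruent_trans m n p (A : set 'rV[R]_m) (B : set 'rV[R]_n)
    (C : set 'rV[R]_p) :
  congruent A B -> congruent B C -> congruent A C.
Proof.
move=> /congruentP[s [e [bs H]]] /congruentP[s' [e' [bs' H']]]; apply/congruentP.
exists (s \o s'), (fun j => e' j (+) e (s' j)); split; first exact: bij_comp.
move=> x; rewrite H H'; set y := signed_perm _ _ _; set z := signed_perm _ _ _.
suff -> : y = z by [].
by apply/rowP => j; rewrite !mxE /= mulrA -signr_addb.
Qed.

Definition fv_congr (a b : floral_vertex) : bool :=
  `[< congruent (fv_set a) (fv_set b) >].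

Lemma fv_congr_refl : reflexive fv_congr.
Proof. by move=> a; apply/asboolP; exact: congruent_refl. Qed.

Lemma fv_congr_sym : symmetric fv_congr.
Proof. by move=> a b; apply/asboolP/asboolP; exact: congruent_sym. Qed.

Lemma fv_congr_trans : transitive fv_congr.
Proof.
by move=> b a c /asboolP ab /asboolP bc; apply/asboolP; exact: congruent_trans bc.
Qed.

Canonical fv_congr_equiv :=
  EquivRel fv_congr fv_congr_refl fv_congr_sym fv_congr_trans.

Definition floral_class : Type := {eq_quot fv_congr_equiv}.

HB.instance Definition _ := Choice.on floral_class.
HB.instance Definition _ := EqQuotient.on floral_class.

Definition class_dim (a : floral_class) : nat := fv_dim (repr a).

(** [A] lies in the class of [beta * R^(n - dim beta)]; this does not depend on
    the representative [beta] of [b], and fails if [class_dim b > n]. *)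
Definition in_class n (A : set 'rV[R]_n) (b : floral_class) : Prop :=
  congruent A (row_prod (fv_set (repr b)) [set: 'rV[R]_(n - class_dim b)]).

Fixpoint expr_rename m n (f : 'I_m -> 'I_n) (e : floral_expr m) :
    floral_expr n :=
  match e with
  | Half i b => Half (f i) b
  | Cap e1 e2 => Cap (expr_rename f e1) (expr_rename f e2)
  | Cup e1 e2 => Cup (expr_rename f e1) (expr_rename f e2)
  end.

Lemma expr_vars_rename m n (f : 'I_m -> 'I_n) e :
  expr_vars (expr_rename f e) = map f (expr_vars e).
Proof. by elim: e => //= e1 -> e2 ->; rewrite map_cat. Qed.

Lemma expr_set_rename m n (f : 'I_m -> 'I_n) e (x : 'rV[R]_n) (y : 'rV[R]_m) :
  (forall i, x 0 (f i) = y 0 i) ->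
  expr_set (expr_rename f e) x <-> expr_set e y.
Proof.
move=> xy; elim: e => [i b|e1 IH1 e2 IH2|e1 IH1 e2 IH2] /=; first by rewrite xy.
  by split=> -[/IH1 ? /IH2].
by split=> -[/IH1|/IH2]; by [left | right].
Qed.

Lemma row_prod_floral m n (A : set 'rV[R]_m) (B : set 'rV[R]_n) :
  floral_on [set: 'I_m]%SET A -> floral_on [set: 'I_n]%SET B ->
  floral_on [set: 'I_(m + n)]%SET (row_prod A B).
Proof.
have ln e (x : 'rV[R]_(m + n)) :
    expr_set (expr_rename (@lshift m n) e) x <-> expr_set e (lsubmx x).
  by apply: expr_set_rename => i; rewrite mxE.
have rn e (x : 'rV[R]_(m + n)) :
    expr_set (expr_rename (@rshift m n) e) x <-> expr_set e (rsubmx x).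
  by apply: expr_set_rename => i; rewrite mxE.
have em0 k : #|[set: 'I_k]%SET| = 0%N -> 'I_k -> False.
  by rewrite cardsT card_ord => -> [].
move=> [[m0 ->]|[e1 [u1 I1 ->]]] [[n0 ->]|[e2 [u2 I2 ->]]].
- left; split; last by apply/seteqP; split.
  by move: m0 n0; rewrite !cardsT !card_ord => -> ->.
- right; exists (expr_rename (@rshift m n) e2).
  rewrite expr_vars_rename map_inj_uniq; last exact: rshift_inj.
  split=> //.
    move=> i; rewrite -(@fintype.splitK _ _ i); case: (fintype.split i) => j; first by case: (em0 _ m0 j).
    by rewrite /= mem_map ?inE -?I2 ?inE//; exact: rshift_inj.
  by apply/seteqP; split=> x /=; [move=> [_ /rn] | move=> /rn ?; split].
- right; exists (expr_rename (@lshift m n) e1).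
  rewrite expr_vars_rename map_inj_uniq; last exact: lshift_inj.
  split=> //.
    move=> i; rewrite -(@fintype.splitK _ _ i); case: (fintype.split i) => j; last by case: (em0 _ n0 j).
    by rewrite /= mem_map ?inE -?I1 ?inE//; exact: lshift_inj.
  by apply/seteqP; split=> x /=; [move=> [/ln] | move=> /ln ?; split].
- right; exists (Cap (expr_rename (@lshift m n) e1) (expr_rename (@rshift m n) e2)).
  rewrite /= !expr_vars_rename cat_uniq !map_inj_uniq;
    [|exact: rshift_inj|exact: lshift_inj].
  split.
  + rewrite u1 u2 andbT /=; apply/hasPn => _ /mapP[j _ ->].
    by apply/mapP => -[i _ /eqP]; rewrite eq_rlshift.
  + move=> i; rewrite inE mem_cat -(@fintype.splitK _ _ i); apply/esym/orP.
    case: (fintype.split i) => j; [left|right]; rewrite /= mem_map -?I1 -?I2 ?inE //.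
      exact: lshift_inj.
    exact: rshift_inj.
  + by apply/seteqP; split=> x /= -[/ln ? /rn].
Qed.

Definition fv_prod (a b : floral_vertex) : floral_vertex :=
  FloralVertex (row_prod_floral (fv_floral a) (fv_floral b)).

Lemma fv_one_floral : floral_on [set: 'I_0]%SET [set: 'rV[R]_0].
Proof. by left; split=> //; rewrite cardsT card_ord. Qed.

Definition fv_one : floral_vertex := FloralVertex fv_one_floral.

Definition class_one : floral_class := \pi_floral_class fv_one.
Definition class_mul (a b : floral_class) : floral_class :=
  \pi_floral_class (fv_prod (repr a) (repr b)).

Lemma congruent_reindex m n (A : set 'rV[R]_m) (B : set 'rV[R]_n)
    (s : 'I_n -> 'I_m) :
  bijective s -> (forall x, A x <-> B (\row_j x 0 (s j))) -> congruent A B.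
Proof.
move=> bs H; apply/congruentP; exists s, (fun=> false); split=> // x.
rewrite H; suff -> : \row_j x 0 (s j) = signed_perm s (fun=> false) x by [].
by apply/rowP => j; rewrite !mxE mul1r.
Qed.

Definition ord_sum_map m n m' n' (s : 'I_m -> 'I_m') (t : 'I_n -> 'I_n')
    (i : 'I_(m + n)) : 'I_(m' + n') :=
  match fintype.split i with
  | inl j => lshift n' (s j)
  | inr j => rshift m' (t j)
  end.

Lemma ord_sum_map_can m n m' n' (s : 'I_m -> 'I_m') (t : 'I_n -> 'I_n') s' t' :
  cancel s s' -> cancel t t' ->
  cancel (@ord_sum_map m n m' n' s t) (ord_sum_map s' t').
Proof.
move=> sK tK i; rewrite /ord_sum_map -[in RHS](@fintype.splitK _ _ i).
case: (fintype.split i) => j.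
  by rewrite (@fintype.unsplitK _ _ (inl (s j) : 'I_m' + 'I_n')) sK.
by rewrite (@fintype.unsplitK _ _ (inr (t j) : 'I_m' + 'I_n')) tK.
Qed.

Lemma congruent_prod m n m' n' (A : set 'rV[R]_m) (B : set 'rV[R]_n)
    (A' : set 'rV[R]_m') (B' : set 'rV[R]_n') :
  congruent A A' -> congruent B B' -> congruent (row_prod A B) (row_prod A' B').
Proof.
move=> /congruentP[s [e [[s' sK s'K] H]]] /congruentP[t [f [[t' tK t'K] G]]].
apply/congruentP; exists (ord_sum_map s t).
exists (fun i => match fintype.split i with inl j => e j | inr j => f j end); split.
  by exists (ord_sum_map s' t'); exact: ord_sum_map_can.
move=> x; rewrite /row_prod /= H G; set z := signed_perm _ _ x.
have -> : lsubmx z = signed_perm s e (lsubmx x).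
  by apply/rowP => j; rewrite !mxE /ord_sum_map (@fintype.unsplitK _ _ (inl j : 'I_m' + 'I_n')).
suff -> : rsubmx z = signed_perm t f (rsubmx x) by [].
by apply/rowP => j; rewrite !mxE /ord_sum_map (@fintype.unsplitK _ _ (inr j : 'I_m' + 'I_n')).
Qed.

Lemma floral_class_eq (a b : floral_vertex) :
  congruent (fv_set a) (fv_set b) -> \pi_floral_class a = \pi_floral_class b.
Proof. by move=> ab; apply/eqmodP; exact/asboolP. Qed.

Lemma repr_congruent (a : floral_vertex) :
  congruent (fv_set (repr (\pi_floral_class a))) (fv_set a).
Proof.
have : \pi_floral_class (repr (\pi_floral_class a)) = \pi_floral_class a.
  by rewrite reprK.
by move=> /eqmodP /asboolP.
Qed.

Lemma class_mulA : associative class_mul.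
Proof.
move=> a b c; apply: floral_class_eq.
apply: (congruent_trans
  (congruent_prod (congruent_refl _) (repr_congruent _))).
apply: congruent_sym.
apply: (congruent_trans
  (congruent_prod (repr_congruent _) (congruent_refl _))).
have E := addnA (fv_dim (repr a)) (fv_dim (repr b)) (fv_dim (repr c)).
apply: (@congruent_reindex _ _ _ _ (cast_ord E)).
  by exists (cast_ord (esym E)); [exact: cast_ordK | exact: cast_ordKV].
move=> x /=; rewrite /row_prod /=; set y := \row_j _.
have -> : lsubmx (lsubmx x) = lsubmx y.
  by apply/rowP => j; rewrite !mxE; congr (x 0 _); exact: val_inj.
have -> : rsubmx (lsubmx x) = lsubmx (rsubmx y).
  by apply/rowP => j; rewrite !mxE; congr (x 0 _); exact: val_inj.
have -> : rsubmx x = rsubmx (rsubmx y).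
  by apply/rowP => j; rewrite !mxE; congr (x 0 _); apply: val_inj; rewrite /= addnA.
by split=> [[[? ?] ?]|[? [? ?]]].
Qed.

Lemma class_mulC : commutative class_mul.
Proof.
move=> a b; apply: floral_class_eq => /=.
set m := fv_dim (repr a); set n := fv_dim (repr b).
pose swap p q (i : 'I_(p + q)) : 'I_(q + p) :=
  match fintype.split i with inl j => rshift q j | inr j => lshift p j end.
have swapK p q : cancel (@swap p q) (@swap q p).
  move=> i; rewrite /swap -[in RHS](@fintype.splitK _ _ i); case: (fintype.split i) => j.
    by rewrite (@fintype.unsplitK _ _ (inr j : 'I_q + 'I_p)).
  by rewrite (@fintype.unsplitK _ _ (inl j : 'I_q + 'I_p)).
apply: (@congruent_reindex _ _ _ _ (@swap n m)); first by exists (@swap m n).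
move=> x; rewrite /row_prod /=; set y := \row_j _.
have -> : lsubmx x = rsubmx y.
  by apply/rowP => j; rewrite !mxE /swap (@fintype.unsplitK _ _ (inr j : 'I_n + 'I_m)).
have -> : rsubmx x = lsubmx y.
  by apply/rowP => j; rewrite !mxE /swap (@fintype.unsplitK _ _ (inl j : 'I_n + 'I_m)).
by split=> -[].
Qed.

Lemma class_mul1 : left_id class_one class_mul.
Proof.
move=> a; rewrite -[RHS]reprK; apply: floral_class_eq.
apply: (congruent_trans
  (congruent_prod (repr_congruent _) (congruent_refl _))).
apply: (@congruent_reindex _ _ _ _ (@rshift 0 _)).
  exists (fun i : 'I_(0 + fv_dim (repr a)) => (i : 'I_(fv_dim (repr a)))).
    by move=> i; exact: val_inj.
  by move=> i; exact: val_inj.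
move=> x /=; rewrite /row_prod /=; set y := \row_j _.
suff -> : rsubmx x = y by split=> [[]|].
by apply/rowP => j; rewrite !mxE.
Qed.

Lemma class_mulr1 : right_id class_one class_mul.
Proof. by move=> a; rewrite class_mulC class_mul1. Qed.

Lemma congruent_dim m n (A : set 'rV[R]_m) (B : set 'rV[R]_n) :
  congruent A B -> m = n.
Proof.
by move=> [s [_ [/bij_eq_card + _]]]; rewrite !card_ord.
Qed.

Lemma class_mul_eq1 (a b : floral_class) :
  class_mul a b = class_one -> a = class_one /\ b = class_one.
Proof.
move=> /eqmodP /asboolP /congruent_dim /= /eqP.
rewrite addn_eq0 => /andP[/eqP a0 /eqP b0].
have H c : fv_dim (repr c) = 0%N -> c = class_one.
  rewrite -{2}[c]reprK; case: (repr c) => [n A fA] /= n0.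
  subst n; apply: floral_class_eq => /=.
  suff -> : A = setT by exact: congruent_refl.
  by case: fA => [[]//|[e _]]; elim: e => [[]|e1 + e2|e1 + e2].
by split; exact: H.
Qed.

HB.instance Definition _ := Choice_isMonomialDef.Build floral_class
  class_mulA class_mul1 class_mulr1 class_mul_eq1.
HB.instance Definition _ := MonomialDef_isConomialDef.Build floral_class
  class_mulC.

(** The product of [{malg _[_]}] satisfies [<< a >> * << b >> = << class_mul a b >>]. *)
Definition floral_algebra : Type := {malg rat[floral_class]}.

HB.instance Definition _ := GRing.ComAlgebra.on floral_algebra.

Definition fbasis (a : floral_class) : floral_algebra := << a >>.

Definition linear_extension (f : floral_class -> floral_algebra)
    (x : floral_algebra) : floral_algebra :=
  \sum_(a <- msupp x) x@_a *: f a.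

Definition tangent_cone n (Q : set 'rV[R]_n) (x : 'rV[R]_n) : set 'rV[R]_n :=
  [set v | exists2 e0 : R, 0 < e0 &
    forall e : R, 0 < e -> e <= e0 -> Q (x + e *: v)].

Definition point_class n (Q : set 'rV[R]_n) (x : 'rV[R]_n) (b : floral_class) :
    Prop :=
  in_class (tangent_cone Q x) b.

(** The signs [-1, 0, 1] are encoded as [0, 1, 2]; distinct [s] give distinct
    orthants, all of them nonempty. *)
Definition orthant n (s : {ffun 'I_n -> 'I_3}) : set 'rV[R]_n :=
  [set x | forall i, Num.sg (x 0 i) = (s i : nat)%:R - 1].

Definition orthant_dim n (s : {ffun 'I_n -> 'I_3}) : nat :=
  #|[set i | (s i : nat) != 1%N]%SET|.

Definition m_coef (a b : floral_class) : nat :=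
  #|[set s : {ffun 'I_(class_dim a) -> 'I_3} |
      (orthant_dim s + class_dim b == class_dim a)%N &&
      `[< forall x, orthant s x ->
            fv_set (repr a) x /\ point_class (fv_set (repr a)) x b >]]%SET|.

Definition h_map : floral_algebra -> floral_algebra :=
  linear_extension
    (fun a => \sum_(b \in [set: floral_class]) (m_coef a b)%:R *: fbasis b).

(** [h_map] is bijective, so [xget] selects the unique preimage of [y]. *)
Definition h_inv (y : floral_algebra) : floral_algebra :=
  xget 0 [set x | h_map x = y].

Definition D_map : floral_algebra -> floral_algebra :=
  linear_extension (fun a => 2 ^+ class_dim a *: fbasis a).

Definition unit_cube d (v : 'rV[int]_d) : set 'rV[R]_d :=
  [set x | forall i, (v 0 i)%:~R <= x 0 i <= (v 0 i)%:~R + 1].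

(** Boundedness is automatic for a finite union of unit cubes. *)
Definition integral_generic_orthotope d (P : set 'rV[R]_d) : Prop :=
  (exists V : seq 'rV[int]_d, P = \bigcup_(v in [set` V]) unit_cube v) /\
  (forall x, P x -> floral_arrangement (tangent_cone P x)).

(** For [c = (n, J)], [J] is the set of directions whose factor is an open
    interval; distinct pairs give distinct cubes. *)
Definition open_cube d (c : 'rV[int]_d * {set 'I_d}) : set 'rV[R]_d :=
  [set x | forall i,
    if i \in c.2 then (c.1 0 i)%:~R < x 0 i < (c.1 0 i)%:~R + 1
    else x 0 i == (c.1 0 i)%:~R].

Definition C_count d (a : floral_class) (k : nat) (P : set 'rV[R]_d) : nat :=
  #|` fset_set [set c : 'rV[int]_d * {set 'I_d} |
      [/\ #|c.2| = k, open_cube c `<=` P &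
          forall x, open_cube c x -> point_class P x a]]|.

Definition L_count d (a : floral_class) (P : set 'rV[R]_d) : nat :=
  #|` fset_set [set z : 'rV[int]_d |
      P (map_mx intr z) /\ point_class P (map_mx intr z) a]|.

Definition dilate d (t : nat) (P : set 'rV[R]_d) : set 'rV[R]_d :=
  (fun x => t%:R *: x) @` P.

(** The polynomial is unique, as it is determined by its values at all [t > 0]. *)
Definition L_poly d (a : floral_class) (P : set 'rV[R]_d) : {poly rat} :=
  xget 0 [set p : {poly rat} | forall t : nat, (0 < t)%N ->
    p.[t%:R] = (L_count a (dilate t P))%:R].

Definition L_coef d (a : floral_class) (k : nat) (P : set 'rV[R]_d) : rat :=
  (L_poly a P)`_k.

End FloralArrangements.

(* Main.v *)
Require Import Defs.
From HB Require Import structures.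
From mathcomp Require Import all_boot all_order all_algebra finmap generic_quotient.
From mathcomp Require Import boolp classical_sets functions cardinality fsbigop.
From mathcomp Require Import reals.
From mathcomp.multinomials Require Import monalg.
From mathcomp Require Import zify ring lra.

(** Let [P] be a generic orthotope and [t > 0]. Consider the flags of [tP]: pairs of
    a lattice point [z] of [tP] and a unit cube of [tP] with vertex [z]. Such a cube
    of type [beta] has dimension at most [d - dim beta]; count the flags of type
    [beta] for which the dimension is equal to this bound.

    Counted by vertices: the cone of [tP] at a lattice point of type [alpha] is
    congruent to [alpha * R^(d - dim alpha)], and it shows the cubes around the
    point as generalized orthants. In the cylinder, an orthant of largest dimension
    for its type is such an orthant of [alpha] times one of the
    [2^(d - dim alpha)] open orthants of [R^(d - dim alpha)]. The number of flags is
    therefore the sum over [alpha] of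
    [L_alpha(tP) 2^(d - dim alpha) m_(alpha, beta)] ([card_flags_vertices]).

    Counted by cubes: a unit cube of [tP] that carries a flag of type [beta] is
    constant exactly in the coordinates on which its cone depends. Those are
    integral in [P], so the cube belongs to the subdivision of a cube of [P] of the
    same dimension and type. With [t] positions and [2] ends for each direction, the
    number of flags is [C_(beta, d - dim beta)(P) (2t)^(d - dim beta)]
    ([card_flags_cubes]).

    Comparing the two counts for all [beta] gives in the floral algebra
      [h (sum_alpha L_alpha(tP) 2^(d - dim alpha) e_alpha)
       = sum_beta C_(beta, d - dim beta)(P) (2t)^(d - dim beta) e_beta].
    Applying [D] after [h^-1] turns the factors [2^(d - dim alpha)] into [2^d], and
      [sum_alpha L_alpha(tP) e_alpha
       = sum_beta 2^(-dim beta) C_(beta, d - dim beta)(P) t^(d - dim beta)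
           D (h^-1 e_beta)]
    ([lattice_count_expansion]). This holds for all [t > 0], so it shows that the
    counts are polynomial in [t], and the theorem is the coefficient of [t^k].

    The counts rest on two facts. The floral type of a set is unique, because a
    read-once expression depends on each of its variables ([vertex_depends],
    [in_class_inj]); this also shows that the matrix of [h] is unitriangular for
    the dimension, hence that [h] is bijective. And tangent cones of unions of
    orthants or of cubes are computed by a local rule ([tangent_cone_sign],
    [tangent_cone_cubical]), from which the essential coordinates of a cone are
    those that vanish, respectively are integral, at its apex. *)

Set Implicit Arguments.
Unset Strict Implicit.
Unset Printing Implicit Defensive.

Import Order.TTheory GRing.Theory Num.Theory.

Local Open Scope classical_set_scope.
Local Open Scope ring_scope.

Arguments fv_set {R} f _.

(** * Coordinates on which a set depends *)

(** The type of a cone is read off from the coordinates on which it depends: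
    for a floral arrangement there are exactly [dim] of them. *)
Definition depends (R : realType) n (A : set 'rV[R]_n) (i : 'I_n) : Prop :=
  exists x y : 'rV[R]_n, [/\ forall j, j != i -> x 0 j = y 0 j, A x & ~ A y].

Definition essential (R : realType) n (A : set 'rV[R]_n) : {set 'I_n} :=
  [set i | `[< depends A i >]]%SET.

Lemma essentialP (R : realType) n (A : set 'rV[R]_n) i :
  reflect (depends A i) (i \in essential A).
Proof. by rewrite inE; exact: asboolP. Qed.

Definition splice (R : realType) n (s : seq 'I_n) (x y : 'rV[R]_n) : 'rV[R]_n :=
  \row_j (if j \in s then x 0 j else y 0 j).

Lemma expr_set_ext (R : realType) n (e : floral_expr n) (x y : 'rV[R]_n) :
  (forall i, i \in expr_vars e -> x 0 i = y 0 i) ->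
  expr_set e x -> expr_set e y.
Proof.
elim: e => [i b|e1 IH1 e2 IH2|e1 IH1 e2 IH2] /= H.
- by rewrite (H i) // inE.
- by case=> h1 h2; split; [apply: IH1 h1|apply: IH2 h2] => i hi;
     apply: H; rewrite mem_cat hi ?orbT.
- by case=> h; [left; apply: IH1 h|right; apply: IH2 h] => i hi;
     apply: H; rewrite mem_cat hi ?orbT.
Qed.

Lemma expr_set_splicel (R : realType) n (e : floral_expr n) s (x y : 'rV[R]_n) :
  {subset expr_vars e <= s} -> expr_set e (splice s x y) <-> expr_set e x.
Proof.
by move=> es; split; apply: expr_set_ext => i hi; rewrite mxE es.
Qed.

Lemma expr_set_splicer (R : realType) n (e : floral_expr n) s (x y : 'rV[R]_n) :
  (forall i, i \in expr_vars e -> i \notin s) ->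
  expr_set e (splice s x y) <-> expr_set e y.
Proof.
by move=> es; split; apply: expr_set_ext => i /es/negPf hi; rewrite mxE hi.
Qed.

Lemma expr_set0 (R : realType) n (e : floral_expr n) :
  expr_set e (0 : 'rV[R]_n).
Proof.
elim: e => [i b|e1 IH1 e2 IH2|e1 IH1 e2 IH2] /=; [|by split|by left].
by rewrite mxE lexx; case: b.
Qed.

Lemma uniq_cat_disj (T : eqType) (s1 s2 : seq T) :
  uniq (s1 ++ s2) -> [/\ uniq s1, uniq s2 &
  (forall i, i \in s2 -> i \notin s1)].
Proof.
by rewrite cat_uniq => /and3P[-> /hasPn h ->]; split.
Qed.

Lemma expr_set_proper (R : realType) n (e : floral_expr n) :
  uniq (expr_vars e) -> exists x : 'rV[R]_n, ~ expr_set e x.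
Proof.
elim: e => [i b _|e1 IH1 e2 IH2|e1 IH1 e2 IH2] /=.
- exists (const_mx (if b then -1 else 1)); rewrite mxE; apply/negP.
  by case: b; rewrite -ltNge ?ltrN10 ?ltr01.
- by move=> /uniq_cat_disj[/IH1[x hx] _ _]; exists x => -[].
- move=> /uniq_cat_disj[/IH1[x hx] /IH2[y hy] D].
  exists (splice (expr_vars e1) x y) => -[]; first by rewrite expr_set_splicel.
  by rewrite expr_set_splicer.
Qed.

(** To toggle a leaf of a read-once formula, every sibling on the path to the
    root is frozen to the neutral value of the connective above it; read-once
    means that the siblings can be frozen independently. *)
Lemma expr_set_depends (R : realType) n (e : floral_expr n) i :
  uniq (expr_vars e) -> i \in expr_vars e -> depends (expr_set (R := R) e) i.
Proof.
have agree s (w x y : 'rV[R]_n) : (forall j, j != i -> x 0 j = y 0 j) ->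
    forall j, j != i -> splice s x w 0 j = splice s y w 0 j.
  by move=> xy j /xy E; rewrite !mxE E.
have agree' s (w x y : 'rV[R]_n) : (forall j, j != i -> x 0 j = y 0 j) ->
    forall j, j != i -> splice s w x 0 j = splice s w y 0 j.
  by move=> xy j /xy E; rewrite !mxE E.
elim: e => [k b _|e1 IH1 e2 IH2|e1 IH1 e2 IH2] /=.
- rewrite inE => /eqP ->.
  exists 0, (\row_j (if j == k then (if b then -1 else 1) else 0)); split=> /=.
  + by move=> j /negPf jk; rewrite !mxE jk.
  + by rewrite mxE lexx; case: b.
  + by rewrite mxE eqxx; apply/negP; case: b; rewrite -ltNge ?ltrN10 ?ltr01.
- move=> /uniq_cat_disj[/IH1{}IH1 /IH2{}IH2 D].
  rewrite mem_cat => /orP[/IH1|/IH2] [x [y [xy hx hy]]].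
  + exists (splice (expr_vars e1) x 0), (splice (expr_vars e1) y 0).
    split; first exact: agree.
      by split; [rewrite expr_set_splicel|rewrite expr_set_splicer//; exact: expr_set0].
    by case; rewrite expr_set_splicel.
  + exists (splice (expr_vars e1) 0 x), (splice (expr_vars e1) 0 y).
    split; first exact: agree'.
      by split; [rewrite expr_set_splicel//; exact: expr_set0|rewrite expr_set_splicer].
    by case => _; rewrite expr_set_splicer.
- move=> /uniq_cat_disj[u1 u2 D].
  have [w1 hw1] := expr_set_proper R u1; have [w2 hw2] := expr_set_proper R u2.
  rewrite mem_cat => /orP[/(IH1 u1)|/(IH2 u2)] [x [y [xy hx hy]]].
  + exists (splice (expr_vars e1) x w2), (splice (expr_vars e1) y w2).
    split; first exact: agree.
      by left; rewrite expr_set_splicel.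
    by case; [rewrite expr_set_splicel|rewrite expr_set_splicer].
  + exists (splice (expr_vars e1) w1 x), (splice (expr_vars e1) w1 y).
    split; first exact: agree'.
      by right; rewrite expr_set_splicer.
    by case; [rewrite expr_set_splicel|rewrite expr_set_splicer].
Qed.

Lemma vertex_depends (R : realType) (a : floral_vertex R) i :
  depends (fv_set a) i.
Proof.
case: a i => n A /= [[n0 _] i|[e [ue Ie ->]] i].
  by move: (ltn_ord i); rewrite cardsT card_ord in n0; rewrite [X in (_ < X)%N]n0.
by apply: expr_set_depends => //; rewrite -Ie inE.
Qed.

(** * Pullbacks along signed coordinate projections *)

(** [A] is the cylinder over [B] in the coordinates selected by [f], up to the
    reflections recorded by [e]; for [m = n] this is congruence. *)
Definition pullback (R : realType) n m (f : 'I_m -> 'I_n) (e : 'I_m -> bool)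
    (B : set 'rV[R]_m) (A : set 'rV[R]_n) : Prop :=
  injective f /\ forall x, A x <-> B (signed_perm f e x).

(** A right inverse of [signed_perm f e], with [0] in the coordinates outside the
    image of [f]. *)
Definition section (R : realType) n m (f : 'I_m -> 'I_n) (e : 'I_m -> bool)
    (w : 'rV[R]_m) : 'rV[R]_n :=
  \row_i (if [pick j | f j == i] is Some j then (-1) ^+ e j * w 0 j else 0).

Lemma pick_inj n m (f : 'I_m -> 'I_n) j :
  injective f -> [pick k | f k == f j] = Some j.
Proof.
by move=> fI; case: pickP => [k /eqP/fI ->//|/(_ j)]; rewrite eqxx.
Qed.

Lemma sectionE (R : realType) n m (f : 'I_m -> 'I_n) e (w : 'rV[R]_m) j :
  injective f -> section f e w 0 (f j) = (-1) ^+ e j * w 0 j.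
Proof. by move=> fI; rewrite mxE pick_inj. Qed.

Lemma sectionK (R : realType) n m (f : 'I_m -> 'I_n) e (w : 'rV[R]_m) :
  injective f -> signed_perm f e (section f e w) = w.
Proof.
move=> fI; apply/rowP => j.
by rewrite mxE sectionE// mulrA -expr2 sqrr_sign mul1r.
Qed.

Lemma pullback_comp (R : realType) n m p (f : 'I_m -> 'I_n) e
    (g : 'I_p -> 'I_m) e' (C : set 'rV[R]_p) B A :
  pullback f e B A -> pullback g e' C B ->
  pullback (f \o g) (fun j => e' j (+) e (g j)) C A.
Proof.
move=> [fI AB] [gI BC]; split=> [|x]; first exact: inj_comp.
rewrite AB BC; set y := signed_perm _ _ _; set z := signed_perm _ _ _.
suff -> : y = z by [].
by apply/rowP => j; rewrite !mxE /= mulrA -signr_addb.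
Qed.

Lemma pullback_essential (R : realType) n m (f : 'I_m -> 'I_n) e
    (B : set 'rV[R]_m) A :
  pullback f e B A -> essential A = (f @: essential B)%SET.
Proof.
move=> [fI AB]; apply/setP => i; apply/essentialP/imsetP.
- move=> [x [y [xy /AB Ax Ay]]].
  have [/codomP[j ij]|fi] := boolP (i \in codom f); last first.
    case: Ay; apply/AB; suff <- : signed_perm f e x = signed_perm f e y by [].
    apply/rowP => j; rewrite !mxE xy //.
    by apply: contraNneq fi => <-; exact: codom_f.
  exists j => //; apply/essentialP.
  exists (signed_perm f e x), (signed_perm f e y); split=> //.
    by move=> k kj; rewrite !mxE xy // ij inj_eq.
  by move=> By; apply: Ay; apply/AB.
- move=> [j /essentialP[x [y [xy Bx By]]] ->].
  exists (section f e x), (section f e y); split; last 2 first.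
  + by apply/AB; rewrite sectionK.
  + by move/AB; rewrite sectionK.
  move=> k kfj; rewrite !mxE; case: pickP => // l /eqP lk.
  by rewrite xy //; apply: contraNneq kfj => <-; rewrite lk.
Qed.

(** If [A] is a cylinder over both [B] and [C] and [C] depends on all its
    coordinates, then these are among the coordinates of [B], so that [B] is
    itself a cylinder over [C]. *)
Lemma pullback_factor (R : realType) n m p (f : 'I_m -> 'I_n) e
    (g : 'I_p -> 'I_n) e' (B : set 'rV[R]_m) (C : set 'rV[R]_p) A :
  pullback f e B A -> pullback g e' C A -> (forall j, depends C j) ->
  exists h e'', pullback h e'' C B.
Proof.
move=> fBA gCA dC.
have gf j : exists k, g j = f k.
  have: g j \in essential A.
    rewrite (pullback_essential gCA); apply: imset_f; exact/essentialP.
  by rewrite (pullback_essential fBA) => /imsetP[k _ ->]; exists k.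
have [h gE] := choice gf.
exists h, (fun j => e' j (+) e (h j)); split.
  by move=> j k hjk; apply: (gCA.1); rewrite !gE hjk.
move=> w; have {1}<- := sectionK e w fBA.1; rewrite -fBA.2 gCA.2.
suff -> : signed_perm g e' (section f e w) =
          signed_perm h (fun j => e' j (+) e (h j)) w by [].
by apply/rowP => j; rewrite mxE gE sectionE ?mxE ?mulrA ?signr_addb//; exact: fBA.1.
Qed.

(** The remaining coordinates are numbered by enumerating the complement of the
    image of [f]. *)
Lemma extend_injection n m (f : 'I_m -> 'I_n) : injective f ->
  exists2 s : 'I_(m + (n - m)) -> 'I_n, bijective s & forall j, s (lshift _ j) = f j.
Proof.
move=> fI; have mn : (m <= n)%N by rewrite -(card_ord m) -(card_ord n) (leq_card f).
have cK : #|~: (f @: [set: 'I_m])%SET|%SET = (n - m)%N.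
  have := cardsC (f @: [set: 'I_m])%SET; rewrite card_imset // cardsT !card_ord.
  by lia.
pose s (i : 'I_(m + (n - m))) : 'I_n := match fintype.split i with
  | inl j => f j | inr j => enum_val (cast_ord (esym cK) j) end.
exists s => [|j]; last by rewrite /s (@fintype.unsplitK _ _ (inl j : 'I_m + 'I_(n - m))).
apply: inj_card_bij; last by rewrite !card_ord subnKC.
have sep j k : f j <> enum_val (cast_ord (esym cK) k).
  move=> E; have := enum_valP (cast_ord (esym cK) k).
  by rewrite -E inE imset_f ?inE.
move=> i j; rewrite /s -{2}(@fintype.splitK _ _ i) -{2}(@fintype.splitK _ _ j).
case: (fintype.split i) => i'; case: (fintype.split j) => j'.
- by move=> /fI ->.
- by move=> /sep.
- by move=> /esym /sep.
- by move=> /enum_val_inj /cast_ord_inj ->.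
Qed.

(** A congruence with [beta * R^(n - dim beta)] carries irrelevant data on the
    second factor: what matters is where the coordinates of [beta] go, and any
    injection of them extends to a signed permutation. *)
Lemma in_classP (R : realType) n (A : set 'rV[R]_n) (b : floral_class R) :
  in_class A b <-> exists f e, pullback f e (fv_set (repr b)) A.
Proof.
rewrite /in_class /class_dim; set m := fv_dim (repr b); split.
  move=> /congruentP[s [e [bs AB]]].
  exists (s \o lshift _), (e \o lshift _); split.
    by apply: inj_comp; [exact: bij_inj|exact: lshift_inj].
  move=> x; rewrite AB /row_prod /=; set y := lsubmx _; set z := signed_perm _ _ _.
  have -> : y = z by apply/rowP => j; rewrite !mxE.
  by split=> [[]|].
move=> [f [e [fI AB]]]; have [s bs sf] := extend_injection fI.
apply/congruentP; exists s.
exists (fun i => match fintype.split i with inl j => e j | inr _ => false end).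
split=> // x; rewrite AB /row_prod /=; set y := signed_perm _ _ _; set z := lsubmx _.
have -> : y = z.
  apply/rowP => j; rewrite !mxE sf.
  by rewrite (@fintype.unsplitK _ _ (inl j : 'I_m + 'I_(n - m))).
by split=> [|[]].
Qed.

(** Adding free coordinates does not change the floral type. *)
Lemma in_class_pullback (R : realType) n m (f : 'I_m -> 'I_n) e
    (B : set 'rV[R]_m) A b :
  pullback f e B A -> in_class A b <-> in_class B b.
Proof.
move=> fBA; rewrite !in_classP; split=> [[g [e' gA]]|[g [e' gB]]].
  by apply: (pullback_factor fBA gA) => j; exact: vertex_depends.
by exists (f \o g); eexists; exact: pullback_comp fBA gB.
Qed.

Lemma in_class_card (R : realType) n (A : set 'rV[R]_n) b :
  in_class A b -> #|essential A| = class_dim b.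
Proof.
move=> /in_classP[f [e fA]]; rewrite (pullback_essential fA) card_imset; last exact: fA.1.
rewrite -[RHS](card_ord (class_dim b)); apply: eq_card => j.
by rewrite [RHS]inE; apply/essentialP; exact: vertex_depends.
Qed.

Lemma in_class_dim (R : realType) n (A : set 'rV[R]_n) b :
  in_class A b -> (class_dim b <= n)%N.
Proof.
by move=> /in_class_card <-; rewrite -[leqRHS](card_ord n) max_card.
Qed.

(** Both types occupy exactly the coordinates on which [A] depends, so they differ
    by a signed permutation. *)
Lemma in_class_inj (R : realType) n (A : set 'rV[R]_n) b c :
  in_class A b -> in_class A c -> b = c.
Proof.
move=> /[dup] Ab /in_classP[f [e fA]] Ac.
have dbc : class_dim c = class_dim b by rewrite -(in_class_card Ab) (in_class_card Ac).
move: Ac; rewrite (in_class_pullback _ fA) => /in_classP[g [e' [gI BC]]].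
rewrite -[b]reprK -[c]reprK; apply: floral_class_eq; apply/congruentP.
exists g, e'; split=> //; apply: inj_card_bij => //.
by rewrite !card_ord -/(class_dim b) -/(class_dim c) dbc.
Qed.

Lemma in_class_repr (R : realType) (b : floral_class R) :
  in_class (fv_set (repr b)) b.
Proof.
apply/in_classP; exists id, (fun=> false); split=> // x.
suff -> : signed_perm id (fun=> false) x = x by [].
by apply/rowP => j; rewrite mxE mul1r.
Qed.

Lemma expr_rename_id n (e : floral_expr n) f :
  (forall i, i \in expr_vars e -> f i = i) -> expr_rename f e = e.
Proof.
elim: e => [i b|e1 IH1 e2 IH2|e1 IH1 e2 IH2] /= H; first by rewrite H ?inE.
  by rewrite IH1 ?IH2 // => i hi; apply: H; rewrite mem_cat hi ?orbT.
by rewrite IH1 ?IH2 // => i hi; apply: H; rewrite mem_cat hi ?orbT.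
Qed.

Lemma expr_rename_comp n m p (e : floral_expr n) (f : 'I_n -> 'I_m) (g : 'I_m -> 'I_p) :
  expr_rename g (expr_rename f e) = expr_rename (g \o f) e.
Proof. by elim: e => //= e1 -> e2 ->. Qed.

Lemma pi_in_class (R : realType) (a : floral_vertex R) :
  in_class (fv_set a) (\pi_(floral_class R)%qT a).
Proof.
have /congruent_sym/congruentP[s [e [bs H]]] := repr_congruent a.
by apply/in_classP; exists s, e; split=> //; exact: bij_inj.
Qed.

Lemma floral_in_class (R : realType) n (A : set 'rV[R]_n) :
  floral_arrangement A -> exists b, in_class A b.
Proof.
move=> [I [[_ ->]|[e [ue Ie ->]]]].
  have f : 'I_0 -> 'I_n by case.
  exists (\pi_(floral_class R)%qT (fv_one R)).
  apply/(@in_class_pullback _ _ _ f (fun=> false) setT); last exact: pi_in_class.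
  by split=> [[]|].
have [i0 i0I] : exists i, i \in I.
  suff [i ie] : exists i, i \in expr_vars e by exists i; rewrite Ie.
  elim: e {ue Ie} => [i _|e1 [i ie] e2 _|e1 [i ie] e2 _] /=; exists i.
  + by rewrite inE.
  + by rewrite mem_cat ie.
  + by rewrite mem_cat ie.
pose rank := enum_rank_in i0I.
have fl : floral_on [set: 'I_#|I|]%SET (expr_set (R := R) (expr_rename rank e)).
  right; exists (expr_rename rank e); rewrite expr_vars_rename; split=> //.
    rewrite map_inj_in_uniq // => i j ie je.
    by apply: (can_in_inj (enum_rankK_in i0I)); rewrite Ie.
  move=> k; rewrite inE; apply/esym/mapP; exists (enum_val k).
    by rewrite -Ie enum_valP.
  by rewrite /rank enum_valK_in.
exists (\pi_(floral_class R)%qT (FloralVertex fl)).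
apply/(@in_class_pullback _ _ _ enum_val (fun=> false)); last exact: pi_in_class.
split=> [|x /=]; first exact: enum_val_inj.
rewrite -{1}[e](@expr_rename_id _ _ (enum_val \o rank)); last first.
  by move=> i; rewrite -Ie /= => /(enum_rankK_in i0I) ->.
rewrite -expr_rename_comp; apply: expr_set_rename => i.
by rewrite mxE mul1r.
Qed.

(** * Sign vectors *)

(** Unions of generalized orthants. *)
Definition sign_invariant (R : realType) n (A : set 'rV[R]_n) : Prop :=
  forall x y : 'rV[R]_n, (forall i, Num.sg (x 0 i) = Num.sg (y 0 i)) -> A x -> A y.

(** The point of the orthant [s] with coordinates in [{-1, 0, 1}]. *)
Definition sign_point (R : realType) n (s : {ffun 'I_n -> 'I_3}) : 'rV[R]_n :=
  \row_i ((s i : nat)%:R - 1).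
Arguments sign_point R {n} s.

Definition signs (R : realType) n (x : 'rV[R]_n) : {ffun 'I_n -> 'I_3} :=
  [ffun i => if x 0 i == 0 then inord 1 else if 0 < x 0 i then inord 2 else ord0].

Lemma ord3P (k : 'I_3) : [\/ k = ord0, k = inord 1 | k = inord 2].
Proof.
case: k => [[|[|[|//]]] p]; [constructor 1|constructor 2|constructor 3];
  by apply: val_inj; rewrite /= ?inordK.
Qed.

Lemma sg_sign_point (R : realType) n (s : {ffun 'I_n -> 'I_3}) i :
  Num.sg (sign_point R s 0 i) = sign_point R s 0 i.
Proof.
rewrite mxE; case: (ord3P (s i)) => ->; rewrite /= ?inordK ?sub0r ?subrr//.
- by rewrite sgrN1.
- by rewrite sgr0.
- by rewrite (_ : 2%:R - 1 = 1 :> R) ?sgr1 //; ring.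
Qed.

Lemma sign_point_eq0 (R : realType) n (s : {ffun 'I_n -> 'I_3}) i :
  (sign_point R s 0 i == 0) = ((s i : nat) == 1%N).
Proof. by rewrite mxE subr_eq0 pnatr_eq1. Qed.

Lemma signsK (R : realType) n (x : 'rV[R]_n) i :
  sign_point R (signs x) 0 i = Num.sg (x 0 i).
Proof.
rewrite mxE ffunE; case: (ltrgt0P (x 0 i)) => [x0|x0|->].
- by rewrite inordK // gtr0_sg //; ring.
- by rewrite ltr0_sg //= sub0r.
- by rewrite inordK // sgr0 subrr.
Qed.

Lemma expr_set_sign_invariant (R : realType) n (e : floral_expr n) :
  sign_invariant (expr_set (R := R) e).
Proof.
move=> x y xy; elim: e => [i b|e1 IH1 e2 IH2|e1 IH1 e2 IH2] /=.
- by rewrite -[0 <= x 0 i]sgr_ge0 -[x 0 i <= 0]sgr_le0 xy sgr_ge0 sgr_le0.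
- by case=> /IH1 ? /IH2.
- by case=> [/IH1|/IH2]; [left|right].
Qed.

Lemma vertex_sign_invariant (R : realType) (a : floral_vertex R) :
  sign_invariant (fv_set a).
Proof.
by case: a => n A /= [[_ ->]|[e [_ _ ->]]] //; exact: expr_set_sign_invariant.
Qed.

Lemma pullback_sign_invariant (R : realType) n m (f : 'I_m -> 'I_n) e
    (B : set 'rV[R]_m) A :
  pullback f e B A -> sign_invariant B -> sign_invariant A.
Proof.
move=> [_ AB] sB x y xy /AB Bx; apply/AB; apply: sB Bx => j.
by rewrite !mxE !sgrM xy.
Qed.

(** Up to congruence a floral arrangement of [R^d] is one of finitely many unions
    of orthants, so there are finitely many classes of dimension at most [d]. *)
Lemma finite_classes (R : realType) d :
  finite_set [set a : floral_class R | (class_dim a <= d)%N].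
Proof.
pose cyl (S : {set {ffun 'I_d -> 'I_3}}) := [set x : 'rV[R]_d | signs x \in S].
pose g S := xget (class_one R) [set a | in_class (cyl S) a].
apply: (@sub_finite_set _ _ (g @` setT)); last exact/finite_image/finite_finset.
move=> a /= ad; pose f := widen_ord ad.
have fI : injective f by move=> i j /(congr1 val) /= ij; exact: val_inj.
pose A := [set x : 'rV[R]_d | fv_set (repr a) (signed_perm f (fun=> false) x)].
have pA : pullback f (fun=> false) (fv_set (repr a)) A by split.
have sA := pullback_sign_invariant pA (@vertex_sign_invariant _ _).
pose S : {set {ffun 'I_d -> 'I_3}} := [set s | `[< A (sign_point R s) >]]%SET.
have cA : cyl S = A.
  apply/seteqP; split=> x; rewrite /cyl /= inE.
    by move=> /asboolP; apply: sA => i; rewrite sg_sign_point signsK.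
  by move=> Ax; apply/asboolP; apply: sA Ax => i; rewrite sg_sign_point signsK.
have aS : in_class (cyl S) a by rewrite cA; apply/in_classP; exists f, (fun=> false).
exists S => //; rewrite /g; apply: in_class_inj (aS).
exact: (@xgetPex _ (class_one R) [set b | in_class (cyl S) b]) (ex_intro _ a aS).
Qed.

(** * Tangent cones of locally constant sets *)

Lemma small_scale (R : realType) (a r : R) : 0 < r ->
  exists2 e0 : R, 0 < e0 & forall e, 0 < e -> e <= e0 -> `|e * a| < r.
Proof.
move=> r0; have a1 : 0 < `|a| + 1 by rewrite ltr_wpDl.
exists (r / (`|a| + 1)); first exact: divr_gt0.
move=> e e0; rewrite ler_pdivlMr // => er; rewrite normrM (gtr0_norm e0).
by apply: lt_le_trans er; rewrite ltr_pM2l // ltrDl ltr01.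
Qed.

(** A step that is small enough for each of the finitely many coordinates. *)
Lemma eventually_all (R : realType) n (P : 'I_n -> R -> Prop) :
  (forall i, exists2 e0 : R, 0 < e0 & forall e, 0 < e -> e <= e0 -> P i e) ->
  exists2 e0 : R, 0 < e0 & forall e, 0 < e -> e <= e0 -> forall i, P i e.
Proof.
move=> H; have /choice[f fP] : forall i, exists e0 : R,
    0 < e0 /\ forall e, 0 < e -> e <= e0 -> P i e.
  by move=> i; have [e0 ? ?] := H i; exists e0.
exists (\big[Num.min/1]_i f i).
  by apply: lt_bigmin => [|i _]; [exact: ltr01|exact: (fP i).1].
by move=> e e0 ef i; apply: (fP i).2 => //; apply: (le_trans ef); exact: bigmin_le_cond.
Qed.

(** When membership in [A] is decided coordinatewise by [rho], the tangent cone
    only sees the [rho]-value that each coordinate takes just after leaving [x]. *)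
Lemma tangent_coneE (R : realType) n (rho : R -> R -> Prop) (A : set 'rV[R]_n)
    (x v w : 'rV[R]_n) :
  (forall y z : 'rV[R]_n, (forall i, rho (y 0 i) (z 0 i)) -> A y -> A z) ->
  (forall i, exists2 e0 : R, 0 < e0 & forall e, 0 < e -> e <= e0 ->
     rho (x 0 i + e * v 0 i) (w 0 i) /\ rho (w 0 i) (x 0 i + e * v 0 i)) ->
  tangent_cone A x v <-> A w.
Proof.
move=> Arho /eventually_all[e0 e00 H]; split=> [[e1 e10 K]|Aw].
  have m0 : 0 < Num.min e0 e1 by rewrite lt_min e00.
  have := K _ m0; rewrite ge_min lexx orbT => /(_ isT); apply: Arho => i.
  by rewrite !mxE; apply: (H _ m0 _ i).1; rewrite ge_min lexx.
exists e0 => // e e_gt0 ee0; apply: Arho Aw => i.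
by rewrite !mxE; exact: (H _ e_gt0 ee0 i).2.
Qed.

(** The sign vector of [lex x v] is that of [x + e v] for all small [e > 0]. *)
Definition lex (R : realType) n (x v : 'rV[R]_n) : 'rV[R]_n :=
  \row_i (if x 0 i == 0 then v 0 i else x 0 i).

Lemma tangent_cone_sign (R : realType) n (A : set 'rV[R]_n) (x v : 'rV[R]_n) :
  sign_invariant A -> tangent_cone A x v <-> A (lex x v).
Proof.
move=> sA; apply: (tangent_coneE (rho := fun a b => Num.sg a = Num.sg b)) => // i.
rewrite mxE; case: eqP => [->|/eqP x0].
  exists 1; first exact: ltr01.
  by move=> e e0 _; rewrite add0r sgrM gtr0_sg // mul1r.
have [e0 e00 H] := small_scale (v 0 i) (r := `|x 0 i|) ltac:(by rewrite normr_gt0).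
exists e0 => // e e_gt0 /(H _ e_gt0) {H}.
suff E : `|e * v 0 i| < `|x 0 i| -> Num.sg (x 0 i + e * v 0 i) = Num.sg (x 0 i).
  by move=> /E.
rewrite ltr_norml; case: (ltrgt0P (x 0 i)) x0 => // xi _ /andP[h1 h2].
  by rewrite !gtr0_sg //; lra.
by rewrite !ltr0_sg //; lra.
Qed.

Lemma tangent_cone_sign_eq (R : realType) n (A : set 'rV[R]_n) (x y : 'rV[R]_n) :
  sign_invariant A -> (forall i, Num.sg (x 0 i) = Num.sg (y 0 i)) ->
  tangent_cone A x = tangent_cone A y.
Proof.
move=> sA xy; have E v : forall i, Num.sg (lex x v 0 i) = Num.sg (lex y v 0 i).
  by move=> i; rewrite !mxE -sgr_eq0 xy sgr_eq0; case: ifP.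
apply/seteqP; split=> v /(tangent_cone_sign _ _ sA) H; apply/(tangent_cone_sign _ _ sA);
  by apply: sA H => i; rewrite E.
Qed.

(** A coordinate that is nonzero at [x] can be varied freely along the cone. *)
Lemma tangent_cone_sign_essential (R : realType) n (A : set 'rV[R]_n) (x : 'rV[R]_n) i :
  sign_invariant A -> i \in essential (tangent_cone A x) -> x 0 i = 0.
Proof.
move=> sA /essentialP[v [w [vw Tv Tw]]]; apply/eqP; apply/negPn/negP => xi.
apply: Tw; apply/(tangent_cone_sign _ _ sA); move/(tangent_cone_sign _ _ sA): Tv.
suff -> : lex x v = lex x w by [].
apply/rowP => j; rewrite !mxE; have [->|ji] := eqVneq j i; first by rewrite (negPf xi).
by rewrite vw.
Qed.

Lemma pullback_tangent_cone (R : realType) n m (f : 'I_m -> 'I_n) e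
    (B : set 'rV[R]_m) A x :
  pullback f e B A ->
  pullback f e (tangent_cone B (signed_perm f e x)) (tangent_cone A x).
Proof.
move=> [fI AB]; split=> // v.
have E r : signed_perm f e (x + r *: v) = signed_perm f e x + r *: signed_perm f e v.
  by apply/rowP => j; rewrite !mxE mulrDr mulrCA.
by split=> -[e0 e00 H]; exists e0 => // r r0 re; have := H r r0 re; rewrite AB E.
Qed.

(** * Counting orthants by floral type *)

Definition zeros n (s : {ffun 'I_n -> 'I_3}) : {set 'I_n} :=
  [set i | (s i : nat) == 1%N]%SET.

Lemma orthant_dim_zeros n (s : {ffun 'I_n -> 'I_3}) k :
  (orthant_dim s + k == n)%N = (#|zeros s| == k).
Proof.
have := cardsC (zeros s); rewrite card_ord.
have -> : orthant_dim s = #|~: zeros s|%SET.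
  by apply: eq_card => i; rewrite !inE.
lia.
Qed.

(** The orthants counted by [m_coef], each tested at its point [sign_point s]
    only; this is enough for unions of orthants. *)
Definition orthants (R : realType) n (A : set 'rV[R]_n) (b : floral_class R) :
    {set {ffun 'I_n -> 'I_3}} :=
  [set s | (orthant_dim s + class_dim b == n)%N &&
     `[< A (sign_point R s) /\ point_class A (sign_point R s) b >]]%SET.

Lemma m_coefE (R : realType) (a b : floral_class R) :
  m_coef a b = #|orthants (fv_set (repr a)) b|.
Proof.
apply: eq_card => s; rewrite !inE; congr (_ && _); apply: asbool_equiv_eq.
have sA := @vertex_sign_invariant R (repr a).
split=> [|[As Cs] x xs].
  by apply=> i; rewrite sg_sign_point mxE.
have E i : Num.sg (sign_point R s 0 i) = Num.sg (x 0 i).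
  by rewrite xs sg_sign_point mxE.
split; first exact: sA E As.
by rewrite /point_class -(tangent_cone_sign_eq sA E).
Qed.

(** An orthant is counted only if its dimension is the largest that its type
    allows; then its type depends on exactly the coordinates vanishing on it. *)
Lemma orthants_essential (R : realType) n (A : set 'rV[R]_n) b s :
  sign_invariant A -> s \in orthants A b ->
  zeros s = essential (tangent_cone A (sign_point R s)).
Proof.
move=> sA; rewrite inE orthant_dim_zeros => /andP[/eqP zb /asboolP[_ /in_class_card cb]].
apply/esym/eqP; rewrite eqEcard cb zb leqnn andbT; apply/fintype.subsetP => i.
move=> /(tangent_cone_sign_essential sA) /eqP.
by rewrite sign_point_eq0 inE.
Qed.

(** Over each orthant of [B] that is counted, the orthants of [A] that are counted
    are those that vanish on none of the [n - m] free coordinates: the count is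
    limited to orthants of largest dimension for their type, and a free coordinate
    never contributes to the type. *)
Section OrthantsPullback.
Variables (R : realType) (n m : nat) (f : 'I_m -> 'I_n) (e : 'I_m -> bool).
Variables (B : set 'rV[R]_m) (A : set 'rV[R]_n) (b : floral_class R).
Hypotheses (fBA : pullback f e B A) (sB : sign_invariant B).

Let flip j (k : 'I_3) := if e j then rev_ord k else k.
Let pull (s : {ffun 'I_n -> 'I_3}) : {ffun 'I_m -> 'I_3} :=
  [ffun j => flip j (s (f j))].

Let flipK j : involutive (flip j).
Proof. by rewrite /flip => k; case: (e j) => //; exact: rev_ordK. Qed.

Let flip1 j k : (flip j k == 1%N :> nat) = (k == 1%N :> nat).
Proof. by rewrite /flip; case: (e j) => //; case: (ord3P k) => ->; rewrite /= ?inordK. Qed.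

Let pullE s : sign_point R (pull s) = signed_perm f e (sign_point R s).
Proof.
apply/rowP => j; rewrite !mxE ffunE /flip; case: (e j); last by rewrite mul1r.
by rewrite /= natrB ?ltn_ord //; ring.
Qed.

Let zeros_pull s : (zeros s \subset f @: [set: 'I_m])%SET -> #|zeros s| = #|zeros (pull s)|.
Proof.
move=> zf; suff -> : zeros s = (f @: zeros (pull s))%SET.
  by rewrite card_imset //; exact: fBA.1.
apply/setP => i; apply/idP/imsetP => [|[j]]; last by rewrite inE ffunE flip1 => js ->; rewrite inE.
move=> iz; have /imsetP[j _ ij] := fintype.subsetP zf _ iz.
by exists j => //; move: iz; rewrite !inE ffunE flip1 ij.
Qed.

Let mem_orthants s :
  (s \in orthants A b) = (pull s \in orthants B b) && (zeros s \subset f @: [set: 'I_m])%SET.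
Proof.
have sA := pullback_sign_invariant fBA sB.
have K : `[< A (sign_point R s) /\ point_class A (sign_point R s) b >] =
    `[< B (sign_point R (pull s)) /\ point_class B (sign_point R (pull s)) b >].
  apply: asbool_equiv_eq; rewrite pullE /point_class.
  by rewrite (in_class_pullback _ (pullback_tangent_cone _ fBA)) fBA.2.
have [zf|zf] := boolP (zeros s \subset _).
  by rewrite andbT !inE !orthant_dim_zeros (zeros_pull zf) K.
rewrite andbF; apply: contraNF zf => /(orthants_essential sA) ->.
by rewrite (pullback_essential (pullback_tangent_cone _ fBA)) imsetS ?finset.subsetT.
Qed.

Let card_fiber (s' : {ffun 'I_m -> 'I_3}) :
  #|[set s | (pull s == s') && (zeros s \subset f @: [set: 'I_m])]%SET|%SET = (2 ^ (n - m))%N.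
Proof.
have fI := fBA.1.
(* the signs that [s] may take at [i]: one on the image of [f], two outside *)
pose F i : pred 'I_3 := if [pick j | f j == i] is Some j
  then pred1 (flip j (s' j)) else predC1 (inord 1).
have -> : #|[set s | (pull s == s') && (zeros s \subset f @: [set: 'I_m])]%SET|%SET = #|family F|.
  apply: eq_card => s; rewrite inE; apply/andP/familyP => [[/eqP sE zf] i|H].
    rewrite /F; case: pickP => [j /eqP <-|ni]; first by rewrite -sE ffunE flipK inE eqxx.
    rewrite !inE; apply/eqP => si; have /(fintype.subsetP zf)/imsetP[j _ ij] : i \in zeros s.
      by rewrite inE si inordK.
    by have := ni j; rewrite ij eqxx.
  split.
    apply/eqP/ffunP => j; have := H (f j); rewrite /F pick_inj // inE => /eqP.
    by rewrite ffunE => ->; rewrite flipK.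
  apply/fintype.subsetP => i; rewrite inE => /eqP si; have := H i; rewrite /F.
  case: pickP => [j /eqP <- _|_]; first by rewrite imset_f.
  by rewrite !inE => /eqP[]; apply: val_inj; rewrite /= si inordK.
rewrite card_family foldrE big_map big_enum /=.
rewrite (bigID (fun i => i \in (f @: [set: 'I_m])%SET)) /= big1 ?mul1n; last first.
  by move=> i /imsetP[j _ ->]; rewrite /F pick_inj // card1.
rewrite (eq_bigr (fun=> 2%N)); last first.
  move=> i ni; rewrite /F; case: pickP => [j /eqP ji|_]; last by rewrite cardC1 card_ord.
  by rewrite -ji imset_f in ni.
rewrite prod_nat_const; congr (2 ^ _)%N.
have := cardsC (f @: [set: 'I_m])%SET; rewrite card_imset // cardsT !card_ord => C.
have -> : (n - m = #|~: (f @: [set: 'I_m])|%SET)%N by lia.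
by apply: eq_card => i; rewrite [RHS]inE.
Qed.

Lemma card_orthants_pullback : #|orthants A b| = (2 ^ (n - m) * #|orthants B b|)%N.
Proof.
rewrite -sum1_card (partition_big pull (mem (orthants B b))) /=; last first.
  by move=> s; rewrite mem_orthants => /andP[].
rewrite (eq_bigr (fun=> (2 ^ (n - m))%N)) ?sum_nat_const 1?mulnC // => s' s'B.
rewrite sum1dep_card -(card_fiber s'); apply: eq_card => s; rewrite [LHS]inE [RHS]inE mem_orthants.
by case: eqP => [->|]; rewrite ?andbT ?andbF ?s'B.
Qed.

End OrthantsPullback.

Lemma card_orthants_in_class (R : realType) n (A : set 'rV[R]_n) a b :
  in_class A a -> #|orthants A b| = (2 ^ (n - class_dim a) * m_coef a b)%N.
Proof.
move=> /in_classP[f [e fA]].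
by rewrite (card_orthants_pullback b fA) ?m_coefE //; exact: vertex_sign_invariant.
Qed.

(** * Inverting [h] *)

Lemma tangent_cone_vertex0 (R : realType) (a : floral_vertex R) :
  tangent_cone (fv_set a) 0 = fv_set a.
Proof.
have L v : lex (0 : 'rV[R]_(fv_dim a)) v = v by apply/rowP => i; rewrite !mxE eqxx.
have sA := @vertex_sign_invariant R a.
apply/seteqP; split=> v; first by move/(tangent_cone_sign _ _ sA); rewrite L.
by move=> Av; apply/(tangent_cone_sign _ _ sA); rewrite L.
Qed.

Lemma sign_point_zeros (R : realType) n (s : {ffun 'I_n -> 'I_3}) :
  (n <= #|zeros s|)%N -> sign_point R s = 0.
Proof.
move=> zn; have /eqP z : zeros s == [set: 'I_n]%SET.
  by rewrite eqEcard finset.subsetT cardsT card_ord.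
apply/rowP => i; rewrite [RHS]mxE; apply/eqP; rewrite sign_point_eq0.
by have := finset.in_setT i; rewrite -z inE.
Qed.

(** An orthant of a floral vertex of dimension [dim b] and type [b] has dimension
    [0], hence is the origin, where the tangent cone is the vertex itself. *)
Lemma m_coef_dim (R : realType) (a b : floral_class R) :
  m_coef a b != 0%N -> (class_dim b < class_dim a)%N || (a == b).
Proof.
rewrite m_coefE -lt0n card_gt0 => /set0Pn[s].
rewrite inE orthant_dim_zeros => /andP[/eqP zb /asboolP[_ Cb]].
have [//|ba] := ltnP (class_dim b) (class_dim a).
apply/eqP; apply: in_class_inj (in_class_repr a) _.
by move: Cb; rewrite /point_class sign_point_zeros ?zb // tangent_cone_vertex0.
Qed.

Lemma m_coef_id (R : realType) (a : floral_class R) : m_coef a a = 1%N.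
Proof.
rewrite m_coefE; apply/eqP/cards1P; exists [ffun=> inord 1].
apply/setP => s; rewrite [LHS]inE [RHS]inE orthant_dim_zeros.
apply/andP/eqP => [[/eqP ze _]|->].
  have /rowP z := @sign_point_zeros R _ s (eq_leq (esym ze)).
  apply/ffunP => i; rewrite ffunE; apply: val_inj; rewrite /= inordK //; apply/eqP.
  by rewrite -(sign_point_eq0 R) z mxE.
have ze : #|zeros ([ffun=> inord 1] : {ffun 'I_(class_dim a) -> 'I_3})| = class_dim a.
  rewrite -[RHS](card_ord (class_dim a)); apply: eq_card => i.
  by rewrite !inE ffunE inordK.
split; first by rewrite ze.
apply/asboolP; rewrite sign_point_zeros ?ze // /point_class tangent_cone_vertex0.
split; last exact: in_class_repr.
by case: (repr a) => n A /= [[_ ->//]|[e [_ _ ->]]]; exact: expr_set0.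
Qed.

Lemma fset_setP (T : choiceType) (A : set T) x :
  finite_set A -> reflect (A x) (x \in fset_set A).
Proof. by move=> fA; rewrite in_fset_set //; apply: (iffP idP); rewrite inE. Qed.

Section FloralAlgebra.
Variable R : realType.
Implicit Types (x y : floral_algebra R) (a b : floral_class R).

Lemma floral_algebraP x y : (forall a, x@_a = y@_a) -> x = y.
Proof. by move=> H; apply/malgP. Qed.

Lemma fbasisE a b : (fbasis a)@_b = (a == b)%:R.
Proof. exact: mcoeffU1. Qed.

Lemma mcoeff_sum (I : Type) (r : seq I) (p : pred I) (F : I -> floral_algebra R) a :
  (\sum_(i <- r | p i) F i)@_a = \sum_(i <- r | p i) (F i)@_a.
Proof. exact: (raddf_sum (mcoeff a)). Qed.

Lemma mcoeff_sum_basis (S : {fset floral_class R}) (c : floral_class R -> rat) a :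
  (\sum_(b <- S) c b *: fbasis b : floral_algebra R)@_a = if a \in S then c a else 0.
Proof.
rewrite mcoeff_sum; under eq_bigr do rewrite mcoeffZ fbasisE.
case: ifPn => aS.
  rewrite (big_fsetD1 a) //= eqxx mulr1 big1_seq ?addr0 // => b /andP[_].
  by rewrite in_fsetD1 => /andP[/negPf -> _]; rewrite mulr0.
rewrite big1_seq // => b /andP[_ bS]; case: eqP bS => [->|]; last by rewrite mulr0.
by rewrite (negPf aS).
Qed.

Lemma linear_extensionE (f : floral_class R -> floral_algebra R) x
    (S : {fset floral_class R}) :
  (msupp x `<=` S)%fset -> linear_extension f x = \sum_(a <- S) x@_a *: f a.
Proof.
move=> xS; apply: (big_fset_incl _ xS) => a _ ax.
by rewrite mcoeff_outdom // scale0r.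
Qed.

Lemma linear_extension_linear (f : floral_class R -> floral_algebra R) :
  linear (linear_extension f).
Proof.
move=> c x y; pose S := (msupp (c *: x + y) `|` (msupp x `|` msupp y))%fset.
rewrite !(@linear_extensionE f _ S); first last.
- exact: fsubsetUl.
- by apply: fsubset_trans (fsubsetUr _ _); exact: fsubsetUl.
- by apply: fsubset_trans (fsubsetUr _ _); exact: fsubsetUr.
rewrite scaler_sumr -big_split /=; apply: eq_bigr => a _.
by rewrite mcoeffD mcoeffZ scalerDl scalerA.
Qed.

HB.instance Definition _ f := GRing.isLinear.Build rat (floral_algebra R)
  (floral_algebra R) *:%R (linear_extension f) (linear_extension_linear f).

Lemma linear_extension_basis (f : floral_class R -> floral_algebra R) a :
  linear_extension f (fbasis a) = f a.
Proof.
rewrite (@linear_extensionE f _ [fset a]%fset) ?big_seq_fset1; last by rewrite msuppU1.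
by rewrite fbasisE eqxx scale1r.
Qed.

HB.instance Definition _ := GRing.Linear.copy (@h_map R) (linear_extension _).
HB.instance Definition _ := GRing.Linear.copy (@D_map R) (linear_extension _).

Lemma h_map_sum (I : Type) (r : seq I) (c : I -> rat) (F : I -> floral_algebra R) :
  h_map (\sum_(i <- r) c i *: F i) = \sum_(i <- r) c i *: h_map (F i).
Proof. by rewrite linear_sum; apply: eq_bigr => i _; rewrite linearZ. Qed.

Lemma D_map_sum (I : Type) (r : seq I) (c : I -> rat) (F : I -> floral_algebra R) :
  D_map (\sum_(i <- r) c i *: F i) = \sum_(i <- r) c i *: D_map (F i).
Proof. by rewrite linear_sum; apply: eq_bigr => i _; rewrite linearZ. Qed.

Lemma D_map_basis a : D_map (fbasis a) = 2 ^+ class_dim a *: fbasis a.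
Proof. exact: linear_extension_basis. Qed.

Lemma mcoeff_h_map a b : (h_map (fbasis a))@_b = (m_coef a b)%:R.
Proof.
rewrite /h_map linear_extension_basis.
have fin := finite_classes R (class_dim a); set S := [set b | _] in fin.
rewrite -(fsbig_widen S) //; last first.
  move=> c [_ /= cS]; suff -> : m_coef a c = 0%N by rewrite scale0r.
  apply/eqP; apply: contra_notT cS => /m_coef_dim /orP[/ltnW//|/eqP <-]; exact: leqnn.
rewrite fsbig_finite // mcoeff_sum_basis; case: (fset_setP _ fin) => // bS.
have [->//|/m_coef_dim H] := eqVneq (m_coef a b) 0%N; case: bS.
by case/orP: H => [/ltnW//|/eqP <-]; exact: leqnn.
Qed.

Lemma mcoeff_h x b :
  (h_map x)@_b = \sum_(a <- msupp x) x@_a * (m_coef a b)%:R.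
Proof.
rewrite /h_map /linear_extension mcoeff_sum; apply: eq_bigr => a _.
by rewrite mcoeffZ -mcoeff_h_map /h_map linear_extension_basis.
Qed.

(** [h] is unitriangular for the grading by dimension: a basis element of
    maximal dimension in the support of [x] survives in [h x]. *)
Lemma h_map_inj : injective (@h_map R).
Proof.
apply: raddf_inj => x hx; apply/eqP; rewrite -msupp_eq0; apply/negPn/negP.
move=> /fset0Pn[b0 b0x].
case: (@arg_maxnP (msupp x) [` b0x]%fset xpredT (fun b : msupp x => class_dim (fsval b))) => // b _ bmax.
have := mcoeff_h x (fsval b); rewrite hx mcoeff0 (big_fsetD1 (fsval b)) /=; last exact: valP.
rewrite m_coef_id mulr1 big1_seq ?addr0 => [/esym/eqP|a /andP[_]].
  by rewrite mcoeff_eq0 (valP b).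
rewrite in_fsetD1 => /andP[/negPf ab ax].
have [->|/m_coef_dim] := eqVneq (m_coef a (fsval b)) 0%N; first by rewrite mulr0.
by rewrite ab orbF ltnNge; have /= -> := bmax [` ax]%fset isT.
Qed.

(** By induction on the dimension of [a], as [h e_a - e_a] only involves basis
    elements of smaller dimension. *)
Lemma h_map_surj a : exists x, h_map x = fbasis a.
Proof.
have [n] := ubnP (class_dim a); elim: n a => // n IH a an.
pose r := h_map (fbasis a) - fbasis a.
have rE : r = \sum_(b <- msupp r) r@_b *: fbasis b.
  rewrite [LHS]monalgE; apply: eq_bigr => b _; apply: floral_algebraP => c.
  by rewrite mcoeffZ fbasisE mcoeffU mulr_natr.
suff [x hx] : exists x, h_map x = r.
  by exists (fbasis a - x); rewrite raddfB /= hx /r opprB addrC subrK.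
have H b : b \in msupp r -> exists x, h_map x = fbasis b.
  rewrite -mcoeff_neq0 mcoeffB mcoeff_h_map fbasisE => br; apply: IH.
  have [ab|ab] := eqVneq a b; first by rewrite -ab m_coef_id eqxx subrr eqxx in br.
  move: br; rewrite (negPf ab) subr0 pnatr_eq0 => /m_coef_dim.
  by rewrite (negPf ab) orbF => /leq_trans; apply.
rewrite rE; have K (s : seq (floral_class R)) :
    (forall b, b \in s -> exists x, h_map x = fbasis b) ->
    exists x, h_map x = \sum_(b <- s) r@_b *: fbasis b.
  elim: s => [_|b s IHs Hs]; first by exists 0; rewrite raddf0 big_nil.
  have [x hx] := Hs b (mem_head _ _).
  have [|y hy] := IHs; first by move=> c cs; apply: Hs; rewrite inE cs orbT.
  by exists (r@_b *: x + y); rewrite linearP /= hx hy big_cons.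
exact: K H.
Qed.

Lemma h_invK a : h_map (h_inv (fbasis a)) = fbasis a.
Proof. exact: (@xgetPex _ _ [set x | h_map x = fbasis a] (h_map_surj a)). Qed.

End FloralAlgebra.

(** * Sets made of integral cubes *)

(** [cell_le a b] says that [b] lies in the closure of the cell of [a], where the
    cells of the line are the integers and the open intervals between them. *)
Definition cell_le (R : realType) (a b : R) : Prop :=
  forall n : int, (n%:~R <= a -> n%:~R <= b) /\ (a <= n%:~R -> b <= n%:~R).

(** Unions of cells that contain the closures of their cells. Comparisons with
    integers are preserved when all coordinates are divided by [t], so dilations
    preserve this property. *)
Definition cubical (R : realType) n (Q : set 'rV[R]_n) : Prop :=
  forall x y : 'rV[R]_n, (forall i, cell_le (x 0 i) (y 0 i)) -> Q x -> Q y.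

Lemma cell_le_itv (R : realType) (m : int) (a b : R) :
  m%:~R < a < m%:~R + 1 -> m%:~R <= b <= m%:~R + 1 -> cell_le a b.
Proof.
rewrite -[1 in X in X -> _]/(1%:~R) -[1 in X in _ -> X -> _]/(1%:~R) -!intrD.
move=> /andP[ma am] /andP[mb bm] n; split=> H.
  apply: le_trans mb; rewrite ler_int -ltzD1 -(ltr_int R).
  exact: le_lt_trans am.
apply: (le_trans bm); rewrite ler_int lezD1 -(ltr_int R).
exact: lt_le_trans H.
Qed.

Lemma cell_le_int (R : realType) (a b : R) :
  a \is a Num.int -> cell_le a b -> b = a.
Proof.
move=> /intrP[m ->] /(_ m)[H1 H2].
by apply: le_anti; rewrite H1 // H2.
Qed.

Lemma nonint_itv (R : realType) (a : R) : a \isn't a Num.int ->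
  exists m : int, m%:~R < a < m%:~R + 1.
Proof.
move=> ai; exists (Num.floor a); have /andP[h1 h2] := floor_itv a.
rewrite intrD in h2; rewrite h2 andbT lt_neqAle h1 andbT.
by apply: contra ai => /eqP <-; exact: intr_int.
Qed.

(** Where a coordinate of [x] is an integer, the point moves half a unit in the
    direction [v]; this is the cell into which [x] escapes along [v]. *)
Definition nudge (R : realType) n (x v : 'rV[R]_n) : 'rV[R]_n :=
  \row_i (if x 0 i \is a Num.int then x 0 i + Num.sg (v 0 i) / 2 else x 0 i).

Lemma tangent_cone_cubical (R : realType) n (Q : set 'rV[R]_n) (x v : 'rV[R]_n) :
  cubical Q -> tangent_cone Q x v <-> Q (nudge x v).
Proof.
move=> cQ; apply: (tangent_coneE cQ) => i; rewrite mxE.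
have [/intrP[m ->]|/nonint_itv[m /andP[h1 h2]]] := boolP (x 0 i \is a Num.int).
  have [e0 e00 H] := small_scale (v 0 i) (@ltr01 R).
  exists e0 => // e e_gt0 /(H _ e_gt0); rewrite ltr_norml => /andP[k1 k2] {H}.
  have [v0|v0|->] := ltrgt0P (v 0 i).
  - have ev : 0 < e * v 0 i by exact: mulr_gt0.
    by rewrite gtr0_sg //; split; apply: (@cell_le_itv _ m); apply/andP; split; lra.
  - have ev : e * v 0 i < 0 by rewrite pmulr_rlt0.
    rewrite ltr0_sg //; split; apply: (@cell_le_itv _ (m - 1)); rewrite intrB;
      by apply/andP; split; lra.
  - by rewrite mulr0 sgr0 mul0r.
have [e0 e00 H] := small_scale (v 0 i) (r := Num.min (x 0 i - m%:~R) (m%:~R + 1 - x 0 i))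
  ltac:(by rewrite lt_min !subr_gt0 h1).
exists e0 => // e e_gt0 /(H _ e_gt0).
rewrite lt_min !ltr_norml => /andP[/andP[k1 k2] /andP[k3 k4]].
by split; apply: (@cell_le_itv _ m); apply/andP; split; lra.
Qed.

Lemma tangent_cone_cell (R : realType) n (Q : set 'rV[R]_n) (x y : 'rV[R]_n) :
  cubical Q -> (forall i, cell_le (x 0 i) (y 0 i)) ->
  (forall i, cell_le (y 0 i) (x 0 i)) -> tangent_cone Q x = tangent_cone Q y.
Proof.
move=> cQ xy yx.
have E (u w v : 'rV[R]_n) i : cell_le (u 0 i) (w 0 i) -> cell_le (w 0 i) (u 0 i) ->
    cell_le (nudge u v 0 i) (nudge w v 0 i).
  move=> uw wu; rewrite !mxE; case: ifPn => ui.
    by have -> := cell_le_int ui uw; rewrite ui.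
  by case: ifPn => // wi; move: ui; rewrite (cell_le_int wi wu) wi.
apply/seteqP; split=> v /(tangent_cone_cubical _ _ cQ) H;
  by apply/(tangent_cone_cubical _ _ cQ); apply: cQ H => i; apply: E.
Qed.

Lemma tangent_cone_cubical_essential (R : realType) n (Q : set 'rV[R]_n) (x : 'rV[R]_n) i :
  cubical Q -> i \in essential (tangent_cone Q x) -> x 0 i \is a Num.int.
Proof.
move=> cQ /essentialP[v [w [vw Tv Tw]]]; apply/negPn/negP => xi.
apply: Tw; apply/(tangent_cone_cubical _ _ cQ); move/(tangent_cone_cubical _ _ cQ): Tv.
suff -> : nudge x v = nudge x w by [].
apply/rowP => j; rewrite !mxE; have [->|ji] := eqVneq j i; first by rewrite (negPf xi).
by rewrite vw.
Qed.

Lemma unit_cube_cubical (R : realType) n (v : 'rV[int]_n) :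
  cubical (unit_cube v : set 'rV[R]_n).
Proof.
move=> x y xy vx i; have := vx i; rewrite -[1]/(1%:~R) -intrD.
by move=> /andP[/(xy i _).1 -> /(xy i _).2 ->].
Qed.

Lemma orthotope_cubical (R : realType) n (P : set 'rV[R]_n) :
  integral_generic_orthotope P -> cubical P.
Proof.
move=> [[V ->] _] x y xy [v vV vx]; exists v => //.
exact: unit_cube_cubical vx.
Qed.

Lemma orthotope_bounded (R : realType) n (P : set 'rV[R]_n) :
  integral_generic_orthotope P ->
  exists M : nat, forall x i, P x -> `|x 0 i| <= M%:R.
Proof.
move=> [[V ->] _]; exists (\sum_(v <- V) \sum_i (absz (v 0%R i) + 1))%N => x i [v /= vV vx].
apply: (@le_trans _ _ (absz (v 0%R i) + 1)%:R); last first.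
  rewrite ler_nat (big_rem v) //= (bigD1 i) //=; lia.
have := vx i; rewrite natrD natr_absz intr_norm ler_norml.
by case: (ler0P ((v 0 i)%:~R : R)) => h /andP[h1 h2]; apply/andP; split; lra.
Qed.

(** * Dilations *)

Section Dilate.
Variables (R : realType) (n t : nat) (P : set 'rV[R]_n).
Hypothesis t0 : (0 < t)%N.

Let tR : (0 : R) < t%:R. Proof. by rewrite ltr0n. Qed.

Lemma dilateE x : dilate t P x <-> P (t%:R^-1 *: x).
Proof.
split=> [[y Py <-]|Px]; first by rewrite scalerA mulVf ?scale1r // gt_eqF.
by exists (t%:R^-1 *: x) => //; rewrite scalerA mulfV ?scale1r // gt_eqF.
Qed.

Lemma tangent_cone_dilate x :
  tangent_cone (dilate t P) x = tangent_cone P (t%:R^-1 *: x).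
Proof.
apply/seteqP; split=> v [e0 e00 H].
  exists (e0 / t%:R); first exact: divr_gt0.
  move=> e e_gt0 ee0; have := H (t%:R * e) _ _; rewrite dilateE scalerDr !scalerA.
  by rewrite mulKf ?gt_eqF //; apply; [exact: mulr_gt0|rewrite mulrC -ler_pdivlMr].
exists (e0 * t%:R); first exact: mulr_gt0.
move=> e e_gt0 ee0; apply/dilateE; rewrite scalerDr !scalerA.
by apply: H; [rewrite mulr_gt0 ?invr_gt0|rewrite mulrC ler_pdivrMr].
Qed.

Lemma dilate_cubical : cubical P -> cubical (dilate t P).
Proof.
move=> cP x y xy /dilateE Px; apply/dilateE; apply: cP Px => i m; rewrite !mxE.
rewrite ![t%:R^-1 * _]mulrC !ler_pdivlMr // !ler_pdivrMr //.
have -> : m%:~R * t%:R = (m * t%:Z)%:~R :> R by rewrite intrM.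
exact: xy.
Qed.

Lemma dilate_bounded (M : nat) : (forall x i, P x -> `|x 0 i| <= M%:R) ->
  forall x i, dilate t P x -> `|x 0 i| <= (t * M)%:R.
Proof.
move=> PM _ i [x Px <-]; rewrite mxE normrM normr_nat natrM ler_pM2l //.
exact: PM.
Qed.

End Dilate.

(** * Cubes around a lattice point *)

(** A cube together with one of its vertices is encoded by the vertex [z] and the
    direction [s] in which the cube leaves it; this is the center of the cube. *)
Definition flag_center (R : realType) n (z : 'rV[int]_n) (s : {ffun 'I_n -> 'I_3}) : 'rV[R]_n :=
  \row_i ((z 0 i)%:~R + sign_point R s 0 i / 2).
Arguments flag_center R {n} z s.

Lemma flag_center_int (R : realType) n (z : 'rV[int]_n) (s : {ffun 'I_n -> 'I_3}) i :
  (flag_center R z s 0 i \is a Num.int) = (i \in zeros s).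
Proof.
rewrite mxE inE -(sign_point_eq0 R); apply/idP/eqP => [|->]; last first.
  by rewrite mul0r addr0 intr_int.
move=> /intrP[m H]; have {H} : sign_point R s 0 i = ((m - z 0 i) * 2)%:~R.
  by rewrite intrM intrB -H; field.
rewrite mxE => H; have {H} : (s i : nat)%:Z - 1 = (m - z 0 i) * 2.
  by apply/eqP; rewrite -(eqr_int R) -H intrB.
move=> H; apply/eqP; rewrite subr_eq0 pnatr_eq1; apply/eqP.
by have := ltn_ord (s i); lia.
Qed.

Section Flags.
Variables (R : realType) (n : nat) (Q : set 'rV[R]_n) (z : 'rV[int]_n).
Hypothesis cQ : cubical Q.
Let zR : 'rV[R]_n := map_mx intr z.

Let nudge_lattice v : nudge zR v = \row_i ((z 0 i)%:~R + Num.sg (v 0 i) / 2).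
Proof. by apply/rowP => i; rewrite !mxE intr_int. Qed.

Lemma lattice_cone_sign_invariant : sign_invariant (tangent_cone Q zR).
Proof.
move=> v w vw /(tangent_cone_cubical _ _ cQ) H; apply/(tangent_cone_cubical _ _ cQ).
suff -> : nudge zR w = nudge zR v by [].
by rewrite !nudge_lattice; apply/rowP => i; rewrite !mxE vw.
Qed.

Lemma lattice_cone_flag_center s : tangent_cone Q zR (sign_point R s) <-> Q (flag_center R z s).
Proof.
rewrite (tangent_cone_cubical _ _ cQ) nudge_lattice.
suff -> : \row_i ((z 0 i)%:~R + Num.sg (sign_point R s 0 i) / 2) = flag_center R z s by [].
by apply/rowP => i; rewrite [LHS]mxE [RHS]mxE sg_sign_point.
Qed.

(** The cone at a lattice point sees the whole star of that point: moving from [z]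
    into the orthant [s] and then along [v] ends in the same cell as moving from the
    center of the cube along [v]. *)
Lemma tangent_cone_flag_center s :
  tangent_cone (tangent_cone Q zR) (sign_point R s) = tangent_cone Q (flag_center R z s).
Proof.
apply/seteqP; have E v : nudge zR (lex (sign_point R s) v) = nudge (flag_center R z s) v.
  rewrite nudge_lattice; apply/rowP => i; rewrite [LHS]mxE [RHS]mxE flag_center_int inE.
  rewrite -(sign_point_eq0 R) [lex _ _ 0 i]mxE [flag_center _ _ _ 0 i]mxE.
  case: eqP => [->|_]; first by rewrite mul0r addr0.
  by rewrite sg_sign_point.
split=> v; rewrite (tangent_cone_sign _ _ lattice_cone_sign_invariant);
  by rewrite !(tangent_cone_cubical _ _ cQ) E.
Qed.

Lemma mem_orthants_flag b s : s \in orthants (tangent_cone Q zR) b <->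
  [/\ #|zeros s| = class_dim b, Q (flag_center R z s) & point_class Q (flag_center R z s) b].
Proof.
rewrite inE orthant_dim_zeros /point_class tangent_cone_flag_center; split.
  by move=> /andP[/eqP ? /asboolP[/lattice_cone_flag_center ? ?]].
by case=> -> /lattice_cone_flag_center ? ?; rewrite eqxx; apply/asboolP.
Qed.

Lemma flag_vertex_mem s : Q (flag_center R z s) -> Q zR.
Proof.
apply: cQ => i; rewrite !mxE.
case: (ord3P (s i)) => ->; rewrite /= ?inordK ?subrr ?mul0r ?addr0 //.
  by apply: (@cell_le_itv _ (z 0 i - 1)); rewrite intrB; apply/andP; split; lra.
by apply: (@cell_le_itv _ (z 0 i)); apply/andP; split; lra.
Qed.

End Flags.

(** * Double counting of flags *)

Lemma card_fset_set_list (T : choiceType) (A : set T) (l : seq T) :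
  uniq l -> (forall x, x \in l <-> A x) -> #|` fset_set A| = size l.
Proof.
move=> ul lA; have -> : A = [set` l] by apply/seteqP; split=> x /lA.
apply/perm_size/uniq_perm => // x.
by rewrite in_fset_set ?inE //; apply/idP/idP; rewrite inE.
Qed.

Lemma finite_lattice_box n (M : nat) :
  finite_set [set z : 'rV[int]_n | forall i, (absz (z 0%R i) <= M)%N].
Proof.
pose g (u : {ffun 'I_n -> 'I_(M + M).+1}) : 'rV[int]_n := \row_i ((u i : nat)%:Z - M%:Z).
apply: (@sub_finite_set _ _ (g @` setT)); last exact/finite_image/finite_finset.
move=> z /= zM; exists [ffun i => inord (absz (z 0 i + M%:Z))] => //.
apply/rowP => i; rewrite mxE ffunE inordK; have := zM i; lia.
Qed.

Section Bounded.
Variables (R : realType) (n : nat) (Q : set 'rV[R]_n) (M : nat).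
Hypothesis QM : forall x i, Q x -> `|x 0 i| <= M%:R.

Lemma finite_lattice_points : finite_set [set z : 'rV[int]_n | Q (map_mx intr z)].
Proof.
apply: sub_finite_set (finite_lattice_box n M) => z /= Qz i.
have := QM i Qz; rewrite mxE -intr_norm -[M%:R]/(M%:Z%:~R) ler_int.
lia.
Qed.

Lemma finite_open_cubes (A : set ('rV[int]_n * {set 'I_n})) :
  (forall c, A c -> open_cube c `<=` Q) -> finite_set A.
Proof.
move=> AQ; apply: (@sub_finite_set _ _
  ([set z : 'rV[int]_n | forall i, (absz (z 0%R i) <= M.+1)%N] `*` setT)); last first.
  by apply: finite_setX; [exact: finite_lattice_box|exact: finite_finset].
move=> c /AQ cQ; split=> //= i.
pose x : 'rV[R]_n := \row_i ((c.1 0 i)%:~R + (if i \in c.2 then 1 / 2 else 0)).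
have xc : open_cube c x.
  move=> j; rewrite mxE; case: (j \in c.2); last by rewrite addr0.
  by apply/andP; split; lra.
have := QM i (cQ _ xc); rewrite mxE ler_norml => H.
suff: `|(c.1 0 i)%:~R : R| <= (M.+1)%:R.
  by rewrite -intr_norm -[(M.+1)%:R]/((M.+1)%:Z%:~R) ler_int; lia.
rewrite ler_norml -natr1; move: H; case: (i \in c.2) => /andP[h1 h2]; apply/andP; split; lra.
Qed.

End Bounded.

(** A flag of type [b] is a unit cube of type [b], of the largest dimension
    [n - dim b] allowed by that type, together with one of its vertices. *)
Definition flags (R : realType) n (Q : set 'rV[R]_n) (b : floral_class R) :
    set ('rV[int]_n * {ffun 'I_n -> 'I_3}) :=
  [set p | [/\ #|zeros p.2| = class_dim b, Q (flag_center R p.1 p.2) &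
               point_class Q (flag_center R p.1 p.2) b]].

Lemma L_count_sum (R : realType) n (Q : set 'rV[R]_n) a :
  finite_set [set z : 'rV[int]_n | Q (map_mx intr z)] ->
  L_count a Q = (\sum_(z <- fset_set [set z : 'rV[int]_n | Q (map_mx intr z)])
    `[< point_class Q (map_mx intr z) a >])%N.
Proof.
move=> fQ; set X := fset_set _.
have -> : L_count a Q =
    #|` fset_set ([set z : 'rV[int]_n | Q (map_mx intr z) /\
                     point_class Q (map_mx intr z) a])| by [].
rewrite (@card_fset_set_list _ _
  [seq z <- X | `[< point_class Q (map_mx intr z) a >]]).
- by rewrite size_filter -sum1_count big_mkcond; apply: eq_bigr => z _; case: asboolP.
- by rewrite filter_uniq.
- move=> z; rewrite mem_filter; split=> [/andP[/asboolP ? /(fset_setP _ fQ)]|[Qz /asboolP ->]].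
    by split.
  exact/(fset_setP _ fQ).
Qed.

(** At a lattice point of type [a] the flags of type [b] are the orthants of type
    [b] in the cone, which is a cylinder over [a]. *)
Lemma card_flags_vertices (R : realType) n (Q : set 'rV[R]_n) (M : nat) b :
  cubical Q -> (forall x, Q x -> floral_arrangement (tangent_cone Q x)) ->
  (forall x i, Q x -> `|x 0 i| <= M%:R) ->
  #|` fset_set (flags Q b)| =
  (\sum_(a <- fset_set [set a : floral_class R | (class_dim a <= n)%N])
     L_count a Q * (2 ^ (n - class_dim a) * m_coef a b))%N.
Proof.
move=> cQ flQ QM; have fQ := finite_lattice_points QM.
pose T (z : 'rV[int]_n) := tangent_cone Q (map_mx intr z : 'rV[R]_n).
set X := fset_set [set z : 'rV[int]_n | Q (map_mx intr z)].
rewrite (@card_fset_set_list _ _ [seq (z, s) | z <- X, s <- enum (orthants (T z) b)]).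
- rewrite size_allpairs_dep sumnE big_map.
  under [RHS]eq_bigr do rewrite (L_count_sum _ fQ) big_distrl /=.
  rewrite exchange_big /=; apply: eq_big_seq => z /(fset_setP _ fQ) Qz.
  rewrite -cardE; have [c Tc] := floral_in_class (flQ _ Qz).
  rewrite (card_orthants_in_class _ Tc) (big_fsetD1 c) /=; last first.
    by apply/(fset_setP _ (finite_classes _ _)); exact: in_class_dim Tc.
  rewrite (asboolT Tc) mul1n big1_seq ?addn0 // => a /andP[_].
  rewrite in_fsetD1 => /andP[/eqP ac _]; rewrite asboolF // => Ta.
  by apply: ac; exact: in_class_inj Ta Tc.
- apply: allpairs_uniq_dep; [exact: fset_uniq|by move=> z _; exact: enum_uniq|].
  by move=> [z s] [z' s'] _ _ /= [-> ->].
- move=> [z s]; split=> [/allpairsPdep[z' [s' [_ + [-> ->]]]]|[/= zs Qc Cc]].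
    by rewrite mem_enum => /(mem_orthants_flag _ cQ).
  apply/allpairsPdep; exists z, s; split=> //.
    by apply/(fset_setP _ fQ); exact: flag_vertex_mem Qc.
  by rewrite mem_enum; apply/(mem_orthants_flag _ cQ).
Qed.

Lemma open_cube_cell (R : realType) n (c : 'rV[int]_n * {set 'I_n}) (x y : 'rV[R]_n) i :
  open_cube c x -> open_cube c y -> cell_le (x 0 i) (y 0 i).
Proof.
move=> /(_ i) + /(_ i); case: ifP => _; last by move=> /eqP -> /eqP ->.
by move=> xi /andP[/ltW y1 /ltW y2]; apply: cell_le_itv xi _; rewrite y1.
Qed.

Section Subdivision.
Variables (R : realType) (n t : nat).
Local Notation cube := ('rV[int]_n * {set 'I_n})%type.
Local Notation flag := ('rV[int]_n * {ffun 'I_n -> 'I_3})%type.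
Local Notation place := {ffun 'I_n -> 'I_t.+1 * bool}.

(** A cube of the [t.+1]-fold subdivision of [c] with one of its vertices:
    [(q i).1] places the small cube inside [c], and [(q i).2] tells which of its two
    ends in direction [i] is the vertex. Outside the directions of [c], [q] has to
    take the default value [(0, false)]. *)
Definition subflag (c : cube) (q : place) : flag :=
  (\row_i (c.1 0 i * t.+1%:Z + (q i).1%:Z + (q i).2%:Z),
   [ffun i => if i \in c.2 then if (q i).2 then ord0 else inord 2 else inord 1]).

Definition subflag_inv (p : flag) : cube * place :=
  let w i := p.1 0 i - (p.2 i == ord0)%:Z in
  ((\row_i (w i %/ t.+1%:Z)%Z, ~: zeros p.2)%SET,
   [ffun i => (inord (absz (w i %% t.+1%:Z)%Z), p.2 i == ord0)]).

Definition places (c : cube) := pffun_on (ord0 : 'I_t.+1, false) c.2 predT.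

Lemma places_off c q i : q \in places c -> i \notin c.2 -> q i = (ord0, false).
Proof.
move=> /pffun_onP[/fintype.subsetP H _] ic; apply/eqP; apply: contraNT ic => qi.
exact: H.
Qed.

Lemma zeros_subflag c q : zeros (subflag c q).2 = (~: c.2)%SET.
Proof.
apply/setP => i; rewrite !inE ffunE.
by case: (i \in c.2); case: (q i).2; rewrite /= ?inordK.
Qed.

Lemma subflagK c q : q \in places c -> subflag_inv (subflag c q) = (c, q).
Proof.
move=> qc.
have s0 i : ((subflag c q).2 i == ord0) = (q i).2.
  rewrite ffunE; case: (boolP (i \in c.2)) => ic; last first.
    by rewrite (places_off qc ic) -val_eqE /= inordK.
  by case: (q i).2; rewrite -val_eqE /= ?inordK.
have w i : (subflag c q).1 0 i - ((subflag c q).2 i == ord0)%:Z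
    = c.1 0 i * t.+1%:Z + (q i).1%:Z by rewrite s0 mxE addrK.
have qlt i : (q i).1%:Z < t.+1%:Z by rewrite ltz_nat.
rewrite /subflag_inv zeros_subflag finset.setCK; case: c w qc s0 => N J w qc s0.
congr ((_, _), _).
  apply/rowP => i; rewrite mxE w divzMDl // divz_small ?addr0 //.
  by rewrite qlt andbT.
apply/ffunP => i; rewrite ffunE w s0 modzMDl modz_small ?qlt //.
by rewrite absz_nat inord_val -surjective_pairing.
Qed.

Lemma subflag_invK (p : flag) :
  (forall i, i \in zeros p.2 -> (t.+1%:Z %| p.1 0%R i)%Z) ->
  (subflag_inv p).2 \in places (subflag_inv p).1 /\
  subflag (subflag_inv p).1 (subflag_inv p).2 = p.
Proof.
case: p => z s /= zs; have r_lt i w : (absz (w i %% t.+1%:Z)%Z < t.+1)%N :> Prop.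
  by rewrite -ltz_nat gez0_abs ?modz_ge0 // ltz_pmod.
have s1 i : i \in zeros s -> (s i == ord0) = false.
  by rewrite inE => /eqP si; rewrite -val_eqE /= si.
split.
  apply/pffun_onP; split=> //; apply/fintype.subsetP => i; rewrite !inE ffunE => /eqP qi.
  apply/negP => iz; apply: qi; have iz' : i \in zeros s by rewrite inE.
  rewrite s1 // subr0 (dvdz_mod0P (zs i iz')); by congr (_, _); apply: val_inj; rewrite /= inordK.
congr (_, _).
  apply/rowP => i; rewrite !mxE !ffunE /= inordK ?r_lt //.
  by rewrite gez0_abs ?modz_ge0 // -divz_eq subrK.
apply/ffunP => i; rewrite !ffunE !inE /=.
by case: (ord3P (s i)) => ->; rewrite -?val_eqE /= ?inordK.
Qed.

Lemma flag_center_subflag c q i : q \in places c ->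
  flag_center R (subflag c q).1 (subflag c q).2 0 i =
  (c.1 0 i)%:~R * t.+1%:R + (q i).1%:R + (if i \in c.2 then 1 / 2 else 0).
Proof.
move=> qc; rewrite !mxE ffunE !intrD intrM -!pmulrn.
case: ifPn => ic; last by rewrite (places_off qc ic) /= inordK //; field.
by case: (q i).2; rewrite /= ?inordK //; field.
Qed.

Lemma subflag_open_cube c q : q \in places c ->
  open_cube c (t.+1%:R^-1 *: flag_center R (subflag c q).1 (subflag c q).2).
Proof.
move=> qc i; rewrite mxE flag_center_subflag //.
have t0 : (0 : R) < t.+1%:R by rewrite ltr0n.
have q0 : (0 : R) <= (q i).1%:R by exact: ler0n.
have q1 : (q i).1%:R + 1 <= t.+1%:R :> R by rewrite natr1 ler_nat ltn_ord.
rewrite mulrC; case: (boolP (i \in c.2)) => ic.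
  rewrite ltr_pdivlMr // ltr_pdivrMr // mulrDl mul1r.
  by apply/andP; split; lra.
by rewrite (places_off qc ic) /= !addr0 mulfK // gt_eqF.
Qed.

Lemma card_places c : #|places c| = (((2 * t.+1) ^ #|c.2|)%N).
Proof. by rewrite card_pffun_on cardT -cardE card_prod card_ord card_bool mulnC. Qed.

(** Only the small cubes interior to a cube of [P] of the same dimension carry
    flags: the coordinates that are constant on the small cube are those on which
    its cone depends, and the cone of [P] depends only on integral coordinates. Each
    cube of [P] of type [b] thus carries [t.+1] positions and [2] ends for each of
    its directions. *)
Lemma card_flags_cubes (P : set 'rV[R]_n) (M : nat) b :
  cubical P -> (forall x i, P x -> `|x 0 i| <= M%:R) -> (class_dim b <= n)%N ->
  #|` fset_set (flags (dilate t.+1 P) b)| =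
  (C_count b (n - class_dim b) P * (2 * t.+1) ^ (n - class_dim b))%N.
Proof.
move=> cP PM bn; set Q := dilate _ _; pose k := (n - class_dim b)%N.
have cQ : cubical Q by exact: dilate_cubical.
have tone x : tangent_cone Q x = tangent_cone P (t.+1%:R^-1 *: x) by exact: tangent_cone_dilate.
rewrite /C_count; set A := [set c : cube | _].
have fA : finite_set A by apply: (finite_open_cubes PM) => c [].
pose L : seq (cube * place) := [seq (c, q) | c <- fset_set A, q <- enum (places c)].
have LE c q : (c, q) \in L <-> A c /\ q \in places c.
  split=> [/allpairsPdep[c' [q' [/(fset_setP _ fA) + + [-> ->]]]]|[Ac qc]].
    by rewrite mem_enum.
  by apply/allpairsPdep; exists c, q; rewrite mem_enum; split=> //; exact/(fset_setP _ fA).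
rewrite (@card_fset_set_list _ _ [seq subflag u.1 u.2 | u <- L]).
- rewrite size_map size_allpairs_dep sumnE big_map.
  rewrite (eq_big_seq (fun=> (2 * t.+1) ^ k)%N) => [|c /(fset_setP _ fA)[cJ _ _]].
    by rewrite big_const_seq count_predT iter_addn_0 mulnC.
  by rewrite -cardE card_places cJ.
- rewrite map_inj_in_uniq; last first.
    apply: (can_in_inj (g := subflag_inv)) => -[c q] /LE[_ qc].
    exact: subflagK.
  apply: allpairs_uniq_dep; [exact: fset_uniq|by move=> c _; exact: enum_uniq|].
  by move=> [c q] [c' q'] _ _ /= [-> ->].
- move=> p; split=> [/mapP[[c q] /LE[[cJ cP' cb] qc] ->]|[zb Qp pb]].
    have yc := subflag_open_cube qc.
    split.
    + rewrite zeros_subflag; have := cardsC c.2; rewrite card_ord cJ => E; apply/eqP.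
      by rewrite -(eqn_add2l (n - class_dim b)) E subnK.
    + exact/dilateE/cP'.
    + by rewrite /point_class tone; exact: cb.
  have pO : p.2 \in orthants (tangent_cone Q (map_mx intr p.1)) b.
    by apply/(mem_orthants_flag _ cQ).
  have div i : i \in zeros p.2 -> (t.+1%:Z %| p.1 0%R i)%Z.
    move=> iz; have := iz.
    rewrite (orthants_essential (@lattice_cone_sign_invariant _ _ _ p.1 cQ) pO).
    rewrite (tangent_cone_flag_center _ cQ) tone => /(tangent_cone_cubical_essential cP) /intrP[m].
    have /eqP p0 : sign_point R p.2 0 i == 0 by rewrite sign_point_eq0; rewrite inE in iz.
    rewrite mxE [flag_center _ _ _ _ _]mxE p0 mul0r addr0 => /(canRL (mulVKf _)) H.
    apply/dvdzP; exists m; apply/eqP; rewrite -(eqr_int R) H ?pnatr_eq0 //.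
    by rewrite intrM mulrC -pmulrn.
  have [qc pE] := subflag_invK div; apply/mapP; exists (subflag_inv p) => //.
  move: qc pE; case: (subflag_inv p) => c q /= qc pE; apply/LE; split=> //.
  have yc := subflag_open_cube qc; rewrite pE in yc.
  have Py : P (t.+1%:R^-1 *: flag_center R p.1 p.2) by apply/dilateE.
  split.
  + have := cardsC c.2; rewrite -(zeros_subflag c q) pE zb card_ord => E; apply/eqP.
    by rewrite -(eqn_add2r (class_dim b)) E subnK.
  + by move=> x xc; apply: cP Py => i; exact: open_cube_cell yc xc.
  + move=> x xc; rewrite /point_class (tangent_cone_cell cP (y := t.+1%:R^-1 *: flag_center R p.1 p.2)).
    * by rewrite -tone.
    * by move=> i; exact: open_cube_cell xc yc.
    * by move=> i; exact: open_cube_cell yc xc.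
Qed.

End Subdivision.

(** * The generating function of the lattice point counts *)

Lemma poly_eq_on_pos (p q : {poly rat}) :
  (forall t : nat, (0 < t)%N -> p.[t%:R] = q.[t%:R]) -> p = q.
Proof.
move=> pq; apply/eqP; rewrite -subr_eq0; apply/negPn/negP => nz.
pose rs : seq rat := [seq i.+1%:R | i <- iota 0 (size (p - q))].
have /(max_poly_roots nz) : all (root (p - q)) rs.
  by apply/allP => _ /mapP[i _ ->]; rewrite /root !hornerE pq ?subrr.
rewrite size_map size_iota ltnn => H; apply/notF/H.
rewrite map_inj_uniq ?iota_uniq // => i j /eqP.
by rewrite eqr_nat => /eqP[].
Qed.

Section Orthotope.
Variables (R : realType) (d : nat) (P : set 'rV[R]_d).
Hypothesis hP : integral_generic_orthotope P.

Let Y := fset_set [set a : floral_class R | (class_dim a <= d)%N].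
Let top_count (b : floral_class R) : rat := (C_count b (d - class_dim b) P)%:R.

Let Y_P a : reflect (class_dim a <= d)%N (a \in Y).
Proof. by apply: (iffP (fset_setP _ (finite_classes _ _))). Qed.

(** The flags of the dilated orthotope, counted by vertices and by cubes. *)
Lemma flag_count_eq t b : (class_dim b <= d)%N ->
  (\sum_(a <- Y) L_count a (dilate t.+1 P) * (2 ^ (d - class_dim a) * m_coef a b) =
   C_count b (d - class_dim b) P * (2 * t.+1) ^ (d - class_dim b))%N.
Proof.
move=> bd; have [M PM] := orthotope_bounded hP; have cP := orthotope_cubical hP.
rewrite -(card_flags_cubes t cP PM bd).
have QM := @dilate_bounded _ _ t.+1 _ isT M PM.
rewrite (card_flags_vertices b _ _ QM) //; first exact: dilate_cubical.
move=> x /dilateE Px; rewrite tangent_cone_dilate //.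
by apply: hP.2; exact: Px.
Qed.

Lemma h_map_lattice_counts t :
  h_map (\sum_(a <- Y) (L_count a (dilate t.+1 P) * 2 ^ (d - class_dim a))%:R *: fbasis a)
  = \sum_(b <- Y) (top_count b * (2 * t.+1%:R) ^+ (d - class_dim b)) *: fbasis b.
Proof.
apply: floral_algebraP => b.
rewrite mcoeff_sum_basis h_map_sum mcoeff_sum.
under eq_bigr do rewrite mcoeffZ mcoeff_h_map -natrM.
rewrite -natr_sum; case: ifPn => [/Y_P bd|bY].
  have := flag_count_eq t bd; under eq_bigr do rewrite mulnA.
  by move=> ->; rewrite natrM natrX natrM.
rewrite big1_seq // => a /andP[_ /Y_P ad].
have [->|/m_coef_dim H] := eqVneq (m_coef a b) 0%N; first by rewrite muln0.
case/Y_P: bY; case/orP: H => [/ltnW ba|/eqP <- //]; exact: leq_trans ba ad.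
Qed.

(** The previous identity, solved by [h^-1]; since [D e_a = 2^(dim a) e_a], applying
    [D] turns the factors [2^(d - dim a)] into the constant [2^d]. *)
Lemma lattice_count_expansion t :
  \sum_(a <- Y) (L_count a (dilate t.+1 P))%:R *: fbasis a =
  \sum_(b <- Y) (top_count b / 2 ^+ class_dim b * t.+1%:R ^+ (d - class_dim b))
     *: D_map (h_inv (fbasis b)).
Proof.
pose x : floral_algebra R := \sum_(a <- Y)
  (L_count a (dilate t.+1 P) * 2 ^ (d - class_dim a))%:R *: fbasis a.
have xE : x = \sum_(b <- Y) (top_count b * (2 * t.+1%:R) ^+ (d - class_dim b))
    *: h_inv (fbasis b).
  apply: h_map_inj; rewrite h_map_lattice_counts h_map_sum.
  by apply: eq_bigr => b _; rewrite h_invK.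
have two0 : (2 : rat) ^+ d != 0 by rewrite expf_neq0.
apply: (scalerI two0).
transitivity (D_map x).
  rewrite scaler_sumr D_map_sum [LHS]big_seq [RHS]big_seq; apply: eq_bigr => a /Y_P ad.
  rewrite D_map_basis !scalerA natrM natrX; congr (_ *: _).
  by rewrite -mulrA -exprD subnK // mulrC.
rewrite xE scaler_sumr D_map_sum [LHS]big_seq [RHS]big_seq; apply: eq_bigr => b /Y_P bd.
rewrite scalerA; congr (_ *: _).
have -> : (2 : rat) ^+ d = 2 ^+ (d - class_dim b) * 2 ^+ class_dim b.
  by rewrite -exprD subnK.
have z0 : (2 : rat) ^+ class_dim b != 0 by rewrite expf_neq0.
rewrite exprMn; move: (2 ^+ class_dim b) z0 => z z0.
move: (top_count b) (t.+1%:R ^+ _) (2 ^+ _) => u v w.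
by rewrite -[w * z * _]mulrA [z * _]mulrA [z * _]mulrC mulfVK // mulrCA mulrA.
Qed.

Lemma L_count_outside a t : a \notin Y -> L_count a (dilate t P) = 0%N.
Proof.
move=> aY; suff -> : L_count a (dilate t P) = #|` fset_set (@set0 'rV[int]_d)|.
  by rewrite fset_set0 cardfs0.
rewrite /L_count; congr (#|` fset_set _|); apply/seteqP; split=> // z [_ /in_class_dim].
by move=> ad; case/Y_P: aY.
Qed.

(* the coefficient of [e_a] in the expansion above, as a polynomial in [t] *)
Let ehrhart (a : floral_class R) : {poly rat} :=
  \sum_(b <- Y) (top_count b / 2 ^+ class_dim b * (D_map (h_inv (fbasis b)))@_a)
     *: 'X^(d - class_dim b).

Lemma ehrhartE a t : (0 < t)%N -> (ehrhart a).[t%:R] = (L_count a (dilate t P))%:R.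
Proof.
case: t => // t _; have := congr1 (mcoeff a) (lattice_count_expansion t).
rewrite mcoeff_sum_basis mcoeff_sum.
have -> : (if a \in Y then (L_count a (dilate t.+1 P))%:R else 0) =
    (L_count a (dilate t.+1 P))%:R :> rat.
  by case: ifPn => // aY; rewrite L_count_outside.
move=> ->; rewrite horner_sum; apply: eq_bigr => b _.
by rewrite mcoeffZ hornerZ hornerXn mulrAC.
Qed.

Lemma L_polyE a : L_poly a P = ehrhart a.
Proof.
apply: poly_eq_on_pos => t t0; rewrite ehrhartE //.
exact: (@xgetPex _ 0 [set p : {poly rat} | forall t : nat, (0 < t)%N ->
  p.[t%:R] = (L_count a (dilate t P))%:R] (ex_intro _ _ (@ehrhartE a))).
Qed.

Lemma ehrhart_outside a : a \notin Y -> ehrhart a = 0.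
Proof.
move=> aY; apply: poly_eq_on_pos => t t0.
by rewrite ehrhartE // L_count_outside // horner0.
Qed.

Lemma L_coef_expansion (k : nat) : (k <= d)%N ->
  \sum_(a <- Y) L_coef a k P *: fbasis a =
  (2 : rat) ^ (k%:Z - d%:Z) *:
    (\sum_(b <- Y | (d - class_dim b)%N == k) top_count b *: D_map (h_inv (fbasis b))).
Proof.
move=> kd; apply: floral_algebraP => a; transitivity (ehrhart a)`_k.
  rewrite mcoeff_sum_basis /L_coef L_polyE.
  by case: ifPn => // aY; rewrite ehrhart_outside // coef0.
rewrite mcoeffZ mcoeff_sum coef_sum /= mulr_sumr [RHS]big_mkcond /=.
rewrite [LHS]big_seq [RHS]big_seq; apply: eq_bigr => b /Y_P bd.
rewrite coefZ coefXn eq_sym; case: eqP => [bk|]; last by rewrite mulr0.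
rewrite mcoeffZ mulr1 mulrA; congr (_ * _); rewrite mulrC; congr (_ * _).
have -> : k%:Z - d%:Z = - (class_dim b)%:Z by lia.
by rewrite -exprnN.
Qed.

End Orthotope.

Theorem theorem5p1 (R : realType) (d : nat) (P : set 'rV[R]_d)
    (hP : integral_generic_orthotope P) (k : nat) (hk : (k <= d)%N) :
  \sum_(a \in [set a : floral_class R | (class_dim a <= d)%N])
      L_coef a k P *: fbasis a =
  (2 : rat) ^ (k%:Z - d%:Z) *:
    (\sum_(a \in [set a : floral_class R |
                  (class_dim a <= d)%N /\ (d - class_dim a)%N = k])
        (C_count a (d - class_dim a) P)%:R *: D_map (h_inv (fbasis a))).
Proof.
have fY := finite_classes R d; pose Y := fset_set [set a : floral_class R | (class_dim a <= d)%N].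
transitivity (\sum_(a <- Y) L_coef a k P *: fbasis a); first exact: fsbig_finite.
apply: (etrans (L_coef_expansion hP hk)); congr (_ *: _).
rewrite big_mkcond -/Y.
pose F (b : floral_class R) : floral_algebra R := if (d - class_dim b)%N == k
  then (C_count b (d - class_dim b) P)%:R *: D_map (h_inv (fbasis b)) else 0.
apply: esym; transitivity (\sum_(a \in [set a : floral_class R |
  (class_dim a <= d)%N /\ (d - class_dim a)%N = k]) F a).
  by apply: eq_fsbigr => b; rewrite inE => -[_ bk]; rewrite /F bk eqxx.
apply: fsbig_fwiden => // [b /= [bd _]|b [/= /(fset_setP _ fY) bd nb]].
  exact/(fset_setP _ fY).
by rewrite /F; case: eqP => // bk; case: nb.
Qed.
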